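(* Let $R$ be a Lie conformal algebra and $\rho:R\to \mathrm{gc}(V)$ a representation of $R$, where $R$ and $V$ are free $\mathbb{C}[\partial]$-modules of finite rank. Let $\{e_j\}_{j=1}^n$ be a $\mathbb{C}[\partial]$-basis of $R$, $\{v_i\}_{i=1}^m$ a $\mathbb{C}[\partial]$-basis of $V$, and $\{v_i^*\}_{i=1}^m$ the dual $\mathbb{C}[\partial]$-basis of $V^{*c}$. Let $T\in\mathrm{Chom}(V,R)$ with $T_\lambda(v_i)=\sum_{j=1}^n a_{ij}(\lambda,\partial)e_j$ for $i=1,\dots,m$, and let $$r_T=\sum_{i=1}^m\sum_{j=1}^n a_{ij}(-1\otimes\partial-\partial\otimes1,\ \partial\otimes1)\, e_j\otimes v_i^*\ \in R\otimes V^{*c}.$$ Then $r=r_T-r_T^{21}$ is a solution of the conformal classical Yang-Baxter equation in the Lie conformal algebra $R\ltimes_{\rho^*}V^{*c}$ if and only if $T_0=T_\lambda|_{\lambda=0}:V\to R$ is an $\mathcal{O}$-operator associated with $\rho$.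
   Context: A Lie conformal algebra is a $\mathbb{C}[\partial]$-module $R$ with a $\mathbb{C}$-bilinear map $R\times R\to R[\lambda]$, $(a,b)\mapsto[a_\lambda b]$, such that $[\partial a_\lambda b]=-\lambda[a_\lambda b]$, $[a_\lambda \partial b]=(\partial+\lambda)[a_\lambda b]$, $[a_\lambda b]=-[b_{-\lambda-\partial}a]$ and $[a_\lambda[b_\mu c]]=[[a_\lambda b]_{\lambda+\mu}c]+[b_\mu[a_\lambda c]]$. Convention: for a polynomial $\sum_n\lambda^n c_n$, substituting $-\lambda-\partial$ for $\lambda$ gives $\sum_n(-\lambda-\partial)^nc_n$, with $\partial$ acting on the coefficients; linear maps are extended to polynomials coefficientwise. All tensor products are over $\mathbb{C}$. A representation $\rho:R\to\mathrm{gc}(V)$ of $R$ on a $\mathbb{C}[\partial]$-module $V$ is a $\mathbb{C}$-bilinear assignment $(a,v)\mapsto\rho(a)_\lambda v\in V[\lambda]$ with $\rho(\partial a)_\lambda v=-\lambda\rho(a)_\lambda v$, $\rho(a)_\lambda(\partial v)=(\partial+\lambda)\rho(a)_\lambda v$ and $\rho([a_\lambda b])_{\lambda+\mu}v=\rho(a)_\lambda(\rho(b)_\mu v)-\rho(b)_\mu(\rho(a)_\lambda v)$. $\mathrm{Chom}(V,R)$ is the set of $\mathbb{C}$-linear maps $T_\lambda:V\to R[\lambda]$ with $T_\lambda(\partial v)=(\partial+\lambda)T_\lambda(v)$. The conformal dual $V^{*c}$ is the set of $\mathbb{C}$-linear maps $f_\lambda:V\to\mathbb{C}[\lambda]$ with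 $f_\lambda(\partial v)=\lambda f_\lambda(v)$, with $(\partial f)_\lambda=-\lambda f_\lambda$; the dual basis satisfies $(v_i^* )_\lambda(v_k)=\delta_{ik}$. The dual representation $\rho^*:R\to\mathrm{gc}(V^{*c})$ is $(\rho^*(a)_\lambda f)_\mu v=-f_{\mu-\lambda}(\rho(a)_\lambda v)$. The semi-direct sum $R\ltimes_{\rho^*}V^{*c}$ is the $\mathbb{C}[\partial]$-module $R\oplus V^{*c}$ with $[(a+f)_\lambda(b+g)]=[a_\lambda b]+\rho^*(a)_\lambda g-\rho^*(b)_{-\lambda-\partial}f$. A $\mathbb{C}[\partial]$-module homomorphism $T:V\to R$ is an $\mathcal{O}$-operator associated with $\rho$ if $[T(u)_\lambda T(v)]=T(\rho(T(u))_\lambda v-\rho(T(v))_{-\lambda-\partial}u)$ for all $u,v\in V$. For $s=\sum_i x_i\otimes y_i$, $s^{21}=\sum_i y_i\otimes x_i$. The element $r_T$ is regarded in $L\otimes L$ with $L=R\ltimes_{\rho^*}V^{*c}$; here $a_{ij}(-1\otimes\partial-\partial\otimes1,\partial\otimes1)$ is a polynomial in commuting operators acting on $e_j\otimes v_i^*$. The conformal classical Yang-Baxter equation for $r=\sum_i x_i\otimes y_i$ in a Lie conformal algebra $L$ is $$\sum_{i,j}\big([{x_i}_\mu x_j]\otimes y_i\otimes y_j|_{\mu=1\otimes\partial\otimes1}-x_i\otimes[{x_j}_\mu y_i]\otimes y_j|_{\mu=1\otimes1\otimes\partial}-x_i\otimes x_j\otimes[{y_j}_\mu y_i]|_{\mu=1\otimes\partial\otimes1}\big)=0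 \mod (\partial^{\otimes^3})$$ in $L\otimes L\otimes L$, where $\partial^{\otimes^3}=\partial\otimes1\otimes1+1\otimes\partial\otimes1+1\otimes1\otimes\partial$, ''mod $(\partial^{\otimes^3})$'' means modulo $\partial^{\otimes^3}(L\otimes L\otimes L)$, and the subscript means each power $\mu^n$ is replaced by the $n$-th power of the indicated operator. *)

(* Defs.v *)
From HB Require Import structures.
From mathcomp Require Import all_boot all_algebra ring_quotient.
From mathcomp Require Import boolp classical_sets functions cardinality fsbigop.
From mathcomp Require Import reals.
From mathcomp Require Export complex.

Set Implicit Arguments.
Unset Strict Implicit.
Unset Printing Implicit Defensive.

Import GRing.Theory.
Local Open Scope classical_set_scope.
Local Open Scope ring_scope.

Section FiniteSupport.
Variables (S : pzRingType) (I : choiceType) (V : lmodType S).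
Implicit Types f g : I -> V.

Definition finitely_supported : {pred I -> V} :=
  fun f => `[< finite_set (f @^-1` [set~ 0]) >].

Lemma finitely_supported_submod : submod_closed finitely_supported.
Proof.
split=> [|k f g /asboolP fF /asboolP gF]; apply/asboolP.
  by apply: (sub_finite_set _ (finite_set0 I)) => i /= /(_ erefl).
apply: (@sub_finite_set _ _ (f @^-1` [set~ 0] `|` g @^-1` [set~ 0])).
  move=> i /= kfg; have [f0|/eqP f0] := eqVneq (f i) 0; last by left.
  right=> g0; apply: kfg.
  by rewrite -[LHS]/(k *: f i + g i) f0 g0 scaler0 addr0.
by rewrite finite_setU; split.
Qed.
HB.instance Definition _ :=
  GRing.isSubmodClosed.Build S (I -> V) finitely_supported
    finitely_supported_submod.

Record fsfunct := FSFunct {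
  fsval :> I -> V;
  fsvalP : fsval \in finitely_supported }.

HB.instance Definition _ := [isSub for fsval].
HB.instance Definition _ := [Choice of fsfunct by <:].
HB.instance Definition _ := [SubChoice_isSubLmodule of fsfunct by <:].

(* Junk value 0 when f is not finitely supported. *)
Definition fsfun_of (f : I -> V) : fsfunct := insubd (0 : fsfunct) f.

Definition fssingle (i : I) (v : V) : fsfunct :=
  fsfun_of (fun j => if j == i then v else 0).

Definition fssupp (p : fsfunct) : seq I := finite_support 0 [set: I] p.

Lemma fsfunE f : f \in finitely_supported -> fsfun_of f =1 f.
Proof. by move=> fF i; rewrite /fsfun_of insubdK. Qed.

Lemma fssingleE i v j : fssingle i v j = if j == i then v else 0.
Proof.
rewrite fsfunE //; apply/asboolP/(sub_finite_set _ (finite_set1 i)) => k /=.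
by case: eqP.
Qed.

Lemma fsfunP (p q : fsfunct) : p =1 q -> p = q.
Proof. by move=> pq; apply/val_inj/funext. Qed.

Lemma fsfunDE (p q : fsfunct) i : (p + q) i = p i + q i. Proof. by []. Qed.
Lemma fsfunNE (p : fsfunct) i : (- p) i = - p i. Proof. by []. Qed.
Lemma fsfunZE (k : S) (p : fsfunct) i : (k *: p) i = k *: p i. Proof. by []. Qed.

Lemma mem_fssupp (p : fsfunct) i : (i \in fssupp p) = (p i != 0).
Proof.
have /asboolP pF := fsvalP p.
rewrite in_finite_support ?setTI //; apply/idP/idP.
  by rewrite inE => /eqP.
by move=> /eqP p0; rewrite inE.
Qed.

Section SumOverSupport.
Variables (W : nmodType) (F : I -> V -> W).
Hypothesis F0 : forall i, F i 0 = 0.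

Lemma big_fssupp (p : fsfunct) (s : seq I) :
    uniq s -> {subset fssupp p <= s} ->
  \sum_(i <- fssupp p) F i (p i) = \sum_(i <- s) F i (p i).
Proof.
move=> us ps; symmetry.
rewrite (bigID (mem (fssupp p))) /= [X in _ + X]big1 ?addr0.
  rewrite -big_filter; apply: perm_big; apply: uniq_perm.
  - exact: filter_uniq.
  - exact: finite_support_uniq.
  - move=> i; rewrite mem_filter; apply/andP/idP => [[]//|ip].
    by split=> //; apply: ps.
by move=> i; rewrite mem_fssupp negbK => /eqP ->.
Qed.

Lemma big_fssuppD (p q : fsfunct) :
    (forall i u v, F i (u + v) = F i u + F i v) ->
  \sum_(i <- fssupp (p + q)) F i ((p + q) i) =
  \sum_(i <- fssupp p) F i (p i) + \sum_(i <- fssupp q) F i (q i).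
Proof.
move=> FD; pose s := undup (fssupp p ++ fssupp q ++ fssupp (p + q)).
have us : uniq s by exact: undup_uniq.
have sub z : z \in [:: p; q; p + q] -> {subset fssupp z <= s}.
  rewrite !inE => /or3P[] /eqP -> i iS; rewrite mem_undup !mem_cat iS //=;
    by rewrite ?orbT.
rewrite !(big_fssupp us (sub _ _)) ?inE ?eqxx ?orbT //.
by rewrite -big_split; apply: eq_bigr => i _ /=; rewrite FD.
Qed.

Lemma big_fssingle i v :
  \sum_(j <- fssupp (fssingle i v)) F j (fssingle i v j) = F i v.
Proof.
rewrite (@big_fssupp _ [:: i]) ?big_seq1 ?fssingleE ?eqxx //.
by move=> j; rewrite mem_fssupp fssingleE mem_seq1; case: ifP; rewrite ?eqxx.
Qed.
End SumOverSupport.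

Lemma fssum_apply (J : Type) (r : seq J) (f : J -> fsfunct) i :
  (\sum_(j <- r) f j) i = \sum_(j <- r) f j i.
Proof. by elim/big_rec2: _ => // j y1 y2 _ <-. Qed.
End FiniteSupport.

Section Tensor.
Variables (K : fieldType) (A B : lmodType K).

Local Notation free := (fsfunct (A * B)%type K^o).
Local Notation gen a b := (fssingle (a, b) (1 : K^o) : free).

Definition tensor_relations : set free :=
  [set x | exists c a a' b,
     x = gen (c *: a + a') b - (c *: gen a b + gen a' b)] `|`
  [set x | exists c a b b',
     x = gen a (c *: b + b') - (c *: gen a b + gen a b')].

Definition tensor_kernel : set free :=
  smallest [set W : set free | submod_closed (fun x => x \in W)]
    tensor_relations.

Definition tensor_kernel_pred : {pred free} := fun x => x \in tensor_kernel.

Lemma tensor_kernel_submod : submod_closed tensor_kernel_pred.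
Proof.
split=> [|c u v]; rewrite /tensor_kernel_pred ?unfold_in.
  by apply/mem_set => W [[W0 _] _]; apply/set_mem.
move=> /set_mem uW /set_mem vW; apply/mem_set => W CW.
have [[_ WD] _] := CW.
exact/set_mem/WD/mem_set/(vW W CW)/mem_set/(uW W CW).
Qed.
HB.instance Definition _ :=
  GRing.isSubmodClosed.Build K free tensor_kernel_pred tensor_kernel_submod.

Definition tensor := Quotient.quot tensor_kernel_pred.
HB.instance Definition _ := GRing.Zmodule.on tensor.

Local Open Scope quotient_scope.

Definition tpi (x : free) : tensor := \pi_(Quotient.quot tensor_kernel_pred) x.
Definition trepr (t : tensor) : free := repr t.

Lemma treprK : cancel trepr tpi. Proof. exact: reprK. Qed.

Lemma tensor_eqP (x y : free) :
  reflect (tpi x = tpi y) (x - y \in tensor_kernel_pred).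
Proof. by rewrite Quotient.idealrBE; apply: eqP. Qed.

Let tscale (c : K) (t : tensor) : tensor := tpi (c *: trepr t).

Let pi_scale c x : tpi (c *: x) = tscale c (tpi x).
Proof.
apply/tensor_eqP; rewrite -scalerBr rpredZ //.
by by apply/tensor_eqP; rewrite treprK.
Qed.

Let pi_add x y : tpi (x + y) = tpi x + tpi y :> tensor.
Proof. by rewrite /tpi !piE. Qed.

Let pi_surj t : exists x, t = tpi x.
Proof. by exists (trepr t); rewrite treprK. Qed.

Fact tscalerA a b v : tscale a (tscale b v) = tscale (a * b) v.
Proof. by have [x ->] := pi_surj v; rewrite -!pi_scale scalerA. Qed.
Fact tscale1r : left_id 1 tscale.
Proof. by move=> v; rewrite /tscale scale1r treprK. Qed.
Fact tscalerDr : right_distributive tscale +%R.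
Proof.
move=> c u v; have [x ->] := pi_surj u; have [y ->] := pi_surj v.
by rewrite -pi_add -!pi_scale -pi_add scalerDr.
Qed.
Fact tscalerDl v : {morph tscale^~ v : a b / a + b}.
Proof. move=> a b; have [x ->] := pi_surj v.
by rewrite -!pi_scale scalerDl pi_add. Qed.

HB.instance Definition _ := GRing.Zmodule_isLmodule.Build K tensor
  tscalerA tscale1r tscalerDr tscalerDl.

Definition tens (a : A) (b : B) : tensor := tpi (gen a b).

(* Only meaningful for bilinear [phi]: see [tlift_tens] and [tlift_linear]. *)
Definition tlift (W : lmodType K) (phi : A -> B -> W) (t : tensor) : W :=
  \sum_(x <- fssupp (trepr t)) trepr t x *: phi x.1 x.2.

Lemma pi_tensorZ c x : tpi (c *: x) = c *: tpi x :> tensor.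
Proof. exact: pi_scale. Qed.

Lemma pi_tensor_linear : linear (tpi : free -> tensor).
Proof. by move=> c x y; rewrite pi_add pi_tensorZ. Qed.

Lemma tens_linearl b : linear (tens^~ b).
Proof.
move=> c a a'; rewrite /tens -pi_tensorZ -pi_add; apply/tensor_eqP.
by apply/mem_set => W [_ RW]; apply: RW; left; exists c, a, a', b.
Qed.

Lemma tens_linearr a : linear (tens a).
Proof.
move=> c b b'; rewrite /tens -pi_tensorZ -pi_add; apply/tensor_eqP.
by apply/mem_set => W [_ RW]; apply: RW; right; exists c, a, b, b'.
Qed.

Lemma fs_decomp (x : free) : x = \sum_(i <- fssupp x) x i *: gen i.1 i.2.
Proof.
apply/fsfunP => j.
rewrite fssum_apply.
under eq_bigr => i _ do rewrite fsfunZE fssingleE -surjective_pairing.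
have [js|/[dup] js] := boolP (j \in fssupp x); last first.
  rewrite mem_fssupp negbK => /eqP ->; rewrite big_seq big1 // => i iS.
  by case: eqP => [ji|_]; rewrite ?scaler0 //; move: js; rewrite ji iS.
rewrite (bigD1_seq j) //= ?finite_support_uniq // eqxx big1 ?addr0.
  by rewrite [_ *: _]mulr1.
by move=> i /negPf; rewrite eq_sym => ->; rewrite scaler0.
Qed.

Lemma tensor_span (t : tensor) :
  exists s : seq (A * B), t = \sum_(p <- s) tens p.1 p.2.
Proof.
exists [seq (trepr t i *: i.1, i.2) | i <- fssupp (trepr t)].
rewrite big_map -[LHS]treprK {1}[trepr t]fs_decomp.
elim/big_rec2: _ => [|i y x _ <-] /=.
  by rewrite -(scale0r (tpi 0)) -pi_tensorZ scale0r.
rewrite pi_add pi_tensorZ; congr (_ + _).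
have := tens_linearl i.2 (trepr t i) i.1 0.
have -> : tens 0 i.2 = 0.
  by have := tens_linearl i.2 (-1) 0 0; rewrite !scaleN1r !addNr.
by rewrite !addr0.
Qed.

Section Lift.
Variables (W : lmodType K) (phi : A -> B -> W).
Hypothesis phil : forall b, linear (phi^~ b).
Hypothesis phir : forall a, linear (phi a).

Let ext (x : free) : W := \sum_(i <- fssupp x) x i *: phi i.1 i.2.

Let ext_linear : linear ext.
Proof.
move=> c x y; rewrite /ext.
rewrite (@big_fssuppD _ _ _ _ (fun i (k : K^o) => k *: phi i.1 i.2)).
- congr (_ + _); rewrite scaler_sumr.
  have [->|c0] := eqVneq c 0.
    rewrite scale0r big_seq big1 => [|i]; last by rewrite mem_fssupp eqxx.
    by rewrite big1 // => i _; rewrite scale0r.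
  rewrite (perm_big (fssupp x)) /=.
    by apply: eq_bigr => i _; rewrite scalerA.
  apply: uniq_perm; rewrite ?finite_support_uniq // => i.
  by rewrite !mem_fssupp fsfunZE [c *: _]/(c * _) mulf_eq0 negb_or c0.
- by move=> i; rewrite scale0r.
- by move=> i u v; rewrite scalerDl.
Qed.

Let ext_gen a b : ext (gen a b) = phi a b.
Proof.
rewrite /ext (big_fssingle (F := fun i (k : K^o) => k *: phi i.1 i.2)).
  by rewrite scale1r.
by move=> i; rewrite scale0r.
Qed.

Let extB (u v : free) : ext (u - v) = ext u - ext v.
Proof.
have -> : u - v = (-1 : K) *: v + u by rewrite scaleN1r addrC.
by rewrite ext_linear scaleN1r addrC.
Qed.

Let ext_ker x : x \in tensor_kernel_pred -> ext x = 0.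
Proof.
move=> /set_mem /(_ [set x | ext x = 0]); apply; split=> /=.
  split=> [|c u v]; rewrite ?unfold_in.
    by apply/mem_set; rewrite /= -(subrr 0) extB subrr.
  move=> /set_mem /= u0 /set_mem /= v0; apply/mem_set => /=.
  by rewrite ext_linear u0 v0 scaler0 addr0.
move=> _ [] [c [a [b [b' ->]]]] /=; rewrite extB ext_linear !ext_gen.
  by rewrite phil subrr.
by rewrite phir subrr.
Qed.

Let tlift_pi x : tlift phi (tpi x) = ext x.
Proof.
apply/eqP; rewrite -subr_eq0 -[tlift _ _]/(ext _) -extB ext_ker //.
by apply/tensor_eqP; rewrite treprK.
Qed.

Lemma tlift_tens a b : tlift phi (tens a b) = phi a b.
Proof. by rewrite tlift_pi ext_gen. Qed.

Lemma tlift_linear : linear (tlift phi).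
Proof.
move=> c s t; rewrite -[s]treprK -[t]treprK -pi_tensor_linear !tlift_pi.
exact: ext_linear.
Qed.
End Lift.
End Tensor.

Section TensorMap.
Variable K : fieldType.

Definition tmap (A B A' B' : lmodType K) (f : A -> A') (g : B -> B')
    (t : tensor A B) : tensor A' B' :=
  tlift (fun a b => tens (f a) (g b)) t.

Definition tflip (A B : lmodType K) (t : tensor A B) : tensor B A :=
  tlift (fun a b => tens b a) t.
End TensorMap.

(* [{vpoly V}] is V[lambda]; the value of [p] at [n] is the coefficient of
  lambda^n.  Scalars act on the coefficients.  [{vpoly {vpoly V}}] is
  V[lambda, mu], with lambda acting as [vX] and mu as [vmap vX]. *)

Notation "{ 'vpoly' V }" := (fsfunct nat V) (format "{ 'vpoly'  V }").

Section VectorPolynomials.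
Variables (S : pzRingType) (V : lmodType S).

Definition vconst (v : V) : {vpoly V} := fssingle 0%N v.

Definition vX (p : {vpoly V}) : {vpoly V} :=
  \sum_(n <- fssupp p) fssingle n.+1 (p n).

Definition vmap (S' : pzRingType) (W : lmodType S') (f : V -> W)
    (p : {vpoly V}) : {vpoly W} :=
  \sum_(n <- fssupp p) fssingle n (f (p n)).

(* Substitution of the operator D for the variable: sum_n D^n (g c_n). *)
Definition vsubst (W : nmodType) (g : V -> W) (D : W -> W)
    (p : {vpoly V}) : W :=
  \sum_(n <- fssupp p) iter n D (g (p n)).

Lemma vXE p n : vX p n = if n is n'.+1 then p n' else 0.
Proof.
rewrite /vX fssum_apply; case: n => [|n].
  by rewrite big1 // => i _; rewrite fssingleE.
under eq_bigr => i _ do rewrite fssingleE eqSS.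
have [np|] := boolP (n \in fssupp p).
  rewrite (bigD1_seq n) ?finite_support_uniq //= eqxx big1 ?addr0 //.
  by move=> i /negPf; rewrite eq_sym => ->.
rewrite mem_fssupp negbK => /eqP pn; rewrite pn big1 // => i _.
by case: eqP => // <-.
Qed.

Lemma vmapE (S' : pzRingType) (W : lmodType S') (f : V -> W) p n :
  f 0 = 0 -> vmap f p n = f (p n).
Proof.
move=> f0; rewrite /vmap fssum_apply.
under eq_bigr => i _ do rewrite fssingleE.
have [np|] := boolP (n \in fssupp p).
  rewrite (bigD1_seq n) ?finite_support_uniq //= eqxx big1 ?addr0 //.
  by move=> i /negPf; rewrite eq_sym => ->.
rewrite mem_fssupp negbK => /eqP pn; rewrite pn f0 big1 // => i _.
by case: eqP => // <-; rewrite pn.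
Qed.
End VectorPolynomials.

(* A C[del]-module is an [lmodType {poly K}], with del acting as ['X]. *)

Section ConformalAlgebras.
Variable K : fieldType.

Definition del (V : lmodType {poly K}) (v : V) : V := 'X *: v.

(* The substitution of - lambda - del for lambda. *)
Definition vflip (V : lmodType {poly K}) (p : {vpoly V}) : {vpoly V} :=
  vsubst (@vconst _ V) (fun q => - vX q - del q) p.

Section SesquilinearMaps.
Variables R V : lmodType {poly K}.
Implicit Type rho : R -> V -> {vpoly V}.

Record conformal_sesquilinear rho : Prop := {
  conf_linearl : forall (c : K) a a' v,
    rho (c%:P *: a + a') v = c%:P *: rho a v + rho a' v;
  conf_linearr : forall (c : K) a v v',
    rho a (c%:P *: v + v') = c%:P *: rho a v + rho a v';
  conf_dell : forall a v, rho (del a) v = - vX (rho a v);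
  conf_delr : forall a v, rho a (del v) = del (rho a v) + vX (rho a v) }.

Local Notation const2 v := (vconst (vconst v)).
Local Notation lam := (@vX _ {vpoly V}).
Local Notation mu := (vmap (@vX _ V)).
Local Notation lam_mu := (fun q : {vpoly {vpoly V}} => lam q + mu q).

(* rho(a)_lambda (rho(b)_mu v) *)
Definition act_lam_mu rho a b v : {vpoly {vpoly V}} :=
  vsubst (fun w => vsubst (fun x => const2 x) lam (rho a w)) mu (rho b v).

(* rho(b)_mu (rho(a)_lambda v) *)
Definition act_mu_lam rho a b v : {vpoly {vpoly V}} :=
  vsubst (fun w => vsubst (fun x => const2 x) mu (rho b w)) lam (rho a v).

(* rho([a_lambda b])_(lambda + mu) v *)
Definition act_bracket (br : R -> R -> {vpoly R}) rho a b v
    : {vpoly {vpoly V}} :=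
  vsubst (fun c => vsubst (fun x => const2 x) lam_mu (rho c v)) lam (br a b).
End SesquilinearMaps.

Record lie_conformal (R : lmodType {poly K}) (br : R -> R -> {vpoly R})
    : Prop := {
  lie_sesquilinear : conformal_sesquilinear br;
  lie_skew : forall a b, br a b = - vflip (br b a);
  lie_jacobi : forall a b c,
    act_lam_mu br a b c = act_bracket br br a b c + act_mu_lam br a b c }.

Record conformal_rep (R V : lmodType {poly K}) (br : R -> R -> {vpoly R})
    (rho : R -> V -> {vpoly V}) : Prop := {
  rep_sesquilinear : conformal_sesquilinear rho;
  rep_bracket : forall a b v,
    act_bracket br rho a b v =
      act_lam_mu rho a b v - act_mu_lam rho a b v }.

Record Chom (V R : lmodType {poly K}) (T : V -> {vpoly R}) : Prop := {
  Chom_linear : forall (c : K) u v,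
    T (c%:P *: u + v) = c%:P *: T u + T v;
  Chom_del : forall v, T (del v) = del (T v) + vX (T v) }.

Definition O_operator (R V : lmodType {poly K}) (br : R -> R -> {vpoly R})
    (rho : R -> V -> {vpoly V}) (T : V -> R) : Prop :=
  linear T /\
  forall u v,
    br (T u) (T v) = vmap T (rho (T u) v - vflip (rho (T v) u)).

Definition is_basis (V : lmodType {poly K}) n (e : 'I_n -> V) : Prop :=
  forall x, exists! c : {ffun 'I_n -> {poly K}}, x = \sum_j c j *: e j.

Section ConformalDual.
Variable V : lmodType {poly K}.

Definition is_cdual : {pred V -> {poly K}} := fun f => `[<
  (forall (c : K) u v, f (c%:P *: u + v) = c *: f u + f v) /\
  (forall v, f (del v) = 'X * f v) >].

Lemma is_cdual_zmod : zmod_closed is_cdual.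
Proof.
split=> [|f g /asboolP[fD fX] /asboolP[gD gX]]; apply/asboolP; split.
- by move=> c u v; rewrite -[LHS]/(0 : {poly K}) scaler0 addr0.
- by move=> v; rewrite mulr0.
- move=> c u v; rewrite -[LHS]/(f _ - g _) fD gD.
  by rewrite scalerBr opprD addrACA.
- by move=> v; rewrite -[LHS]/(f _ - g _) fX gX mulrBr.
Qed.
HB.instance Definition _ :=
  GRing.isZmodClosed.Build (V -> {poly K}) is_cdual is_cdual_zmod.

Record cdual := CDual { cdual_fun :> V -> {poly K};
                        cdualP : cdual_fun \in is_cdual }.

HB.instance Definition _ := [isSub for cdual_fun].
HB.instance Definition _ := [Choice of cdual by <:].
HB.instance Definition _ := [SubChoice_isSubZmodule of cdual by <:].

(* As (del f)_lambda = - lambda f_lambda, p(del) acts on f_lambda as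
   multiplication by p(- lambda). *)
Let dscale_fun (p : {poly K}) (f : cdual) (v : V) : {poly K} :=
  (p \Po - 'X) * f v.

Fact dscale_subproof p f : dscale_fun p f \in is_cdual.
Proof.
have /asboolP[fD fX] := cdualP f; apply/asboolP; split=> [c u v|v].
  by rewrite /dscale_fun fD mulrDr scalerAr.
by rewrite /dscale_fun fX mulrCA.
Qed.

Definition dscale p f : cdual := CDual (dscale_subproof p f).

Let cdual_ext (f g : cdual) : f =1 g -> f = g.
Proof. by move=> fg; apply/val_inj/funext. Qed.

Fact dscalerA p q f : dscale p (dscale q f) = dscale (p * q) f.
Proof. by apply: cdual_ext => v; rewrite /= /dscale_fun comp_polyM mulrA. Qed.
Fact dscale1r : left_id 1 dscale.
Proof.
by move=> f; apply: cdual_ext => v; rewrite /= /dscale_fun comp_polyC mul1r.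
Qed.
Fact dscalerDr : right_distributive dscale +%R.
Proof. by move=> p f g; apply: cdual_ext => v; rewrite /= -mulrDr. Qed.
Fact dscalerDl f : {morph dscale^~ f : p q / p + q}.
Proof.
by move=> p q; apply: cdual_ext => v; rewrite /= /dscale_fun comp_polyD mulrDl.
Qed.
HB.instance Definition _ := GRing.Zmodule_isLmodule.Build {poly K} cdual
  dscalerA dscale1r dscalerDr dscalerDl.

Lemma cdualZE p (f : cdual) v : (p *: f) v = (p \Po - 'X) * f v.
Proof. by []. Qed.

Lemma cdual_delE (f : cdual) v : (del f) v = - 'X * f v.
Proof. by rewrite cdualZE comp_polyX. Qed.

Lemma cdual_linear (f : cdual) (p : {poly K}) u v : f (p *: u + v) = p * f u + f v.
Proof.
have /asboolP[fD fX] := cdualP f.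
have f0 : f 0 = 0.
  by have := fD (-1) 0 0; rewrite !scaler0 addr0 scaleN1r addNr.
have fA x y : f (x + y) = f x + f y.
  by have := fD 1 x y; rewrite !scale1r.
rewrite fA; congr (_ + _); elim/poly_ind: p => [|p c IHp].
  by rewrite scale0r mul0r.
rewrite scalerDl mulrC -scalerA fA [f ('X *: _)]fX IHp mulrDl mulrA.
by congr (_ + _); have := fD c u 0; rewrite f0 !addr0 mul_polyC.
Qed.

Definition cdual_of (f : V -> {poly K}) : cdual := insubd (0 : cdual) f.

Lemma cdual_ofE (f : V -> {poly K}) : f \in is_cdual -> cdual_of f =1 f.
Proof. by move=> fP v; rewrite /cdual_of insubdK. Qed.

End ConformalDual.

Section DualRepresentation.
Variables (R V : lmodType {poly K}) (rho : R -> V -> {vpoly V}).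

(* - f_(mu - lambda) (rho(a)_lambda v) in K[lambda, mu], where ['X] is lambda
   and ['X%:P] is mu. *)
Definition dual_rep_poly (a : R) (f : cdual V) (v : V) : {poly {poly K}} :=
  - \sum_(n <- fssupp (rho a v))
      'X^n * (map_poly (fun c => c%:P%:P) (f (rho a v n))).['X%:P - 'X].

(* See [dual_repE]: when V is finitely generated, the default values of
   [fsfun_of] and [cdual_of] are not used. *)
Definition dual_rep (a : R) (f : cdual V) : {vpoly (cdual V)} :=
  fsfun_of (fun n => cdual_of (fun v => (dual_rep_poly a f v)`_n)).

Definition semidirect_bracket (br : R -> R -> {vpoly R})
    (x y : (R * cdual V)%type) : {vpoly (R * cdual V)%type} :=
  vmap (fun a => (a, 0)) (br x.1 y.1) +
  vmap (fun f => (0, f)) (dual_rep x.1 y.2 - vflip (dual_rep y.1 x.2)).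

Lemma dual_rep_poly_linear f a (p : {poly K}) u v :
    conformal_sesquilinear rho ->
  dual_rep_poly a f (p *: u + v) =
    p%:P * dual_rep_poly a f u + dual_rep_poly a f v.
Proof.
move=> sr.
pose S (g : {poly K}) : {poly {poly K}} :=
  (map_poly (fun c => c%:P%:P) g).['X%:P - 'X].
pose F (n : nat) (w : V) : {poly {poly K}} := 'X^n * S (f w).
pose Phi (q : {vpoly V}) := \sum_(n <- fssupp q) F n (q n).
have PE w : dual_rep_poly a f w = - Phi (rho a w) by [].
have f0 : f 0 = 0.
  by have := cdual_linear f (-1) 0 0; rewrite !scaler0 addr0 mulN1r addNr.
have fD x y : f (x + y) = f x + f y.
  by have := cdual_linear f 1 x y; rewrite scale1r mul1r.
have fZ q x : f (q *: x) = q * f x.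
  by have := cdual_linear f q x 0; rewrite f0 !addr0.
have S0 : S 0 = 0 by rewrite /S map_poly0 horner0.
have SD g h : S (g + h) = S g + S h.
  by rewrite /S (rmorphD (map_poly (polyC \o polyC))) hornerD.
have SM g h : S (g * h) = S g * S h.
  by rewrite /S (rmorphM (map_poly (polyC \o polyC))) hornerM.
have SC c : S c%:P = c%:P%:P.
  by rewrite /S (map_polyC (polyC \o polyC)) hornerC.
have SX : S 'X = 'X%:P - 'X.
  by rewrite /S (map_polyX (polyC \o polyC)) hornerX.
have F0 n : F n 0 = 0 by rewrite /F f0 S0 mulr0.
have FD n x y : F n (x + y) = F n x + F n y by rewrite /F fD SD mulrDr.
have PhiD q r : Phi (q + r) = Phi q + Phi r by exact: big_fssuppD.
have PhiZ c q : Phi (c *: q) = S c * Phi q.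
  have sub : {subset fssupp (c *: q) <= fssupp q}.
    move=> n; rewrite !mem_fssupp; apply: contraNneq => q0.
    by rewrite fsfunZE q0 scaler0.
  rewrite /Phi (big_fssupp F0 _ sub) ?finite_support_uniq // mulr_sumr.
  by apply: eq_bigr => n _; rewrite fsfunZE /F fZ SM mulrCA.
have PhiX q : Phi (vX q) = 'X * Phi q.
  rewrite /Phi (big_fssupp F0 (s := map succn (fssupp q))).
  - rewrite big_map mulr_sumr; apply: eq_bigr => n _.
    by rewrite vXE /F exprS mulrA.
  - by rewrite map_inj_uniq ?finite_support_uniq //; apply: succn_inj.
  move=> [|n]; rewrite mem_fssupp vXE ?eqxx // => qn.
  by rewrite mem_map ?mem_fssupp //; apply: succn_inj.
have [_ lr _ dr] := sr.
have Pdel w : dual_rep_poly a f ('X *: w) = 'X%:P * dual_rep_poly a f w.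
  rewrite !PE [rho a _]dr PhiD PhiX PhiZ SX mulrBl.
  by rewrite subrK mulrN.
have PL c x y : dual_rep_poly a f (c%:P *: x + y) =
    c%:P%:P * dual_rep_poly a f x + dual_rep_poly a f y.
  by rewrite !PE lr PhiD PhiZ SC opprD mulrN.
have PA x y : dual_rep_poly a f (x + y) =
    dual_rep_poly a f x + dual_rep_poly a f y.
  by have := PL 1 x y; rewrite !polyC1 scale1r mul1r.
have P0 : dual_rep_poly a f 0 = 0.
  by have := PL (-1) 0 0; rewrite scaler0 addr0 !polyCN !polyC1 mulN1r addNr.
rewrite PA; congr (_ + _); elim/poly_ind: p => [|p c IHp].
  by rewrite scale0r P0 polyC0 mul0r.
rewrite scalerDl mulrC -scalerA PA Pdel IHp.
rewrite polyCD polyCM mulrDl mulrA; congr (_ + _).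
by have := PL c u 0; rewrite P0 !addr0.
Qed.

Lemma dual_repE m (v : 'I_m -> V) :
    conformal_sesquilinear rho ->
    (forall x, exists c : 'I_m -> {poly K}, x = \sum_i c i *: v i) ->
  forall a f n w, dual_rep a f n w = (dual_rep_poly a f w)`_n.
Proof.
move=> sr vgen a f n w.
have Plin := dual_rep_poly_linear f a _ _ _ sr.
have P0 : dual_rep_poly a f 0 = 0.
  have := Plin (-1) 0 0; rewrite scaler0 addr0 polyCN polyC1 mulN1r.
  by rewrite addNr.
have cd k : (fun x => (dual_rep_poly a f x)`_k) \in @is_cdual V.
  apply/asboolP; split=> [c x y|x].
    by rewrite Plin coefD coefCM mul_polyC.
  by have := Plin 'X x 0; rewrite P0 !addr0 => ->; rewrite coefCM.
rewrite fsfunE ?cdual_ofE //; apply/asboolP.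
pose N := \max_(i < m) size (dual_rep_poly a f (v i)).
apply: (@sub_finite_set _ _ `I_N) => // k /= k0.
rewrite ltnNge; apply/negP => Nk; apply: k0; apply/val_inj/funext => x /=.
rewrite cdual_ofE //; have [c ->] := vgen x.
suff -> : dual_rep_poly a f (\sum_i c i *: v i) =
    \sum_i (c i)%:P * dual_rep_poly a f (v i).
  rewrite coef_sum big1 // => i _; rewrite coefCM nth_default ?mulr0 //.
  by apply: leq_trans Nk; apply: (leq_bigmax i).
elim/big_rec2: _ => [//|i y1 y2 _ <-]; exact: Plin.
Qed.
End DualRepresentation.

(* The vector space underlying a C[del]-module. *)
Definition cspace (V : lmodType {poly K}) : Type := V.

Section UnderlyingSpace.
Variable V : lmodType {poly K}.
HB.instance Definition _ := GRing.Zmodule.on (cspace V).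

Let cscale (c : K) (v : cspace V) : cspace V := c%:P *: (v : V).

Fact cscalerA a b v : cscale a (cscale b v) = cscale (a * b) v.
Proof. by rewrite /cscale scalerA polyCM. Qed.
Fact cscale1r : left_id 1 cscale.
Proof. by move=> v; rewrite /cscale scale1r. Qed.
Fact cscalerDr : right_distributive cscale +%R.
Proof. by move=> c u v; rewrite /cscale scalerDr. Qed.
Fact cscalerDl v : {morph cscale^~ v : a b / a + b}.
Proof. by move=> a b; rewrite /cscale polyCD scalerDl. Qed.
HB.instance Definition _ := GRing.Zmodule_isLmodule.Build K (cspace V)
  cscalerA cscale1r cscalerDr cscalerDl.
End UnderlyingSpace.

Definition cdel (V : lmodType {poly K}) : cspace V -> cspace V := @del V.

Definition ctensor (V W : lmodType {poly K}) : lmodType K :=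
  tensor (cspace V) (cspace W).

Definition ctens (V W : lmodType {poly K}) (x : V) (y : W) : ctensor V W :=
  @tens K (cspace V) (cspace W) x y.

Section YangBaxter.
Variables (L : lmodType {poly K}) (br : L -> L -> {vpoly L}).

Local Notation L2 := (ctensor L L).
Local Notation L3 := (tensor L2 (cspace L)).

Definition tens3 (x y z : L) : L3 :=
  @tens K L2 (cspace L) (ctens x y) z.

Definition del1 : L3 -> L3 := tmap (tmap (@cdel L) id) id.
Definition del2 : L3 -> L3 := tmap (tmap id (@cdel L)) id.
Definition del3 : L3 -> L3 := tmap id (@cdel L).

(* The left-hand side for r = sum_i x_i (x) y_i, [s] listing the pairs
   (x_i, y_i). *)
Definition cybe_lhs (s : seq (L * L)) : L3 :=
  \sum_(p <- s) \sum_(q <- s)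
    (vsubst (fun c => tens3 c p.2 q.2) del2 (br p.1 q.1)
     - vsubst (fun c => tens3 p.1 c q.2) del3 (br q.1 p.2)
     - vsubst (fun c => tens3 p.1 q.1 c) del2 (br q.2 p.2)).

(* A decomposition of r exists by [tensor_span]; when the bracket is bilinear,
   [cybe_lhs] does not depend on it. *)
Definition cybe_solution (r : L2) : Prop :=
  forall s : seq (L * L), r = \sum_(p <- s) ctens p.1 p.2 ->
  exists w : L3, cybe_lhs s = del1 w + del2 w + del3 w.
End YangBaxter.

(* a(P, Q) w for commuting operators P and Q, where a(lambda, del) is encoded
   with outer variable lambda and inner variable del. *)
Definition opeval (W : lmodType K) (a : {poly {poly K}}) (P Q : W -> W)
    (w : W) : W :=
  \sum_(k < size a) \sum_(l < size a`_k) a`_k`_l *: iter k P (iter l Q w).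

Definition r_T (R V : lmodType {poly K}) m n (e : 'I_n -> R)
    (vs : 'I_m -> cdual V) (a : 'I_m -> 'I_n -> {poly {poly K}})
    : ctensor R (cdual V) :=
  let dl := tmap (@cdel R) id in
  let dr := tmap id (@cdel (cdual V)) in
  \sum_i \sum_j opeval (a i j) (fun t => - dr t - dl t) dl (ctens (e j) (vs i)).

(* The image of R (x) V^*c in L (x) L for L = R (+) V^*c. *)
Definition tensor_inj (R V : lmodType {poly K}) :
    ctensor R (cdual V) -> ctensor (R * cdual V)%type (R * cdual V)%type :=
  @tmap K (cspace R) (cspace (cdual V))
    (cspace (R * cdual V)%type) (cspace (R * cdual V)%type)
    (fun x : R => (x, 0)) (fun f : cdual V => (0, f)).

End ConformalAlgebras.

(* Main.v *)
From HB Require Import structures.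
Require Import Defs.
From mathcomp Require Import all_boot all_algebra reals.
From mathcomp Require Import boolp fsbigop ring.

Set Implicit Arguments.
Unset Strict Implicit.
Unset Printing Implicit Defensive.

Import GRing.Theory.
Local Open Scope ring_scope.

(** Why the theorem holds.  Put L = R (+) V^*c and let t_i be the value of T_0
    at v_i.

    The Yang-Baxter equation lives in the cokernel of the total derivation on
    L (x) L (x) L.  Let D1, D2, D3 be elements of a polynomial ring in two
    variables with D1 + D2 + D3 = 0, and let al, be, ga be K[del]-linear
    functionals on L.  Then x (x) y (x) z |-> al(x)(D1) be(y)(D2) ga(z)(D3)
    turns the derivation of each tensor factor into the multiplication by the
    corresponding D, hence kills the image of the total derivation ([theta]).
    As L is free of finite rank, the coordinate functionals detect whether an
    element is in that image ([mod_total_criterion]).  So the equation becomes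
    a family of identities between polynomials.  A bracket enters them only
    through its value al([x_M y])(D), written [veval al D M]; there the
    substitution of - lambda - del for lambda is M |-> - M - D
    ([veval_vflip]), and the dual representation is minus the transpose of rho
    ([veval_dual_rep]).

    The left-hand side of the equation does not change when r moves by the
    image of del (x) 1 + 1 (x) del: each of its three terms is compatible with
    the two derivations on the pair (x_i, y_i), by sesquilinearity and
    D1 + D2 + D3 = 0 ([cybe_term_balanced_l], [cybe_term_balanced_r]).  Modulo
    this image, the first argument of the a_ij in r_T is 0, so that r_T is the
    sum of the t_i (x) v_i^* ([balanced_r_T]).

    For this r the left-hand side has components in R (x) V^*c (x) V^*c,
    V^*c (x) R (x) V^*c and V^*c (x) V^*c (x) R only.  Skew-symmetry of the
    bracket makes the last two copies of the first, up to sign and a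
    permutation of the factors ([cybe_term_split]).  Transposing rho in the
    first one collects it as the sum over k, l of

      O(v_k, v_l) (x) v_k^* (x) v_l^*  at lambda = 1 (x) del (x) 1,

    where O(u, w) is the difference between the two sides of the O-operator
    identity ([cybe_RVV_defect]).  Hence the equation holds as soon as O = 0.
    Conversely the coordinates of this sum are those of the O(v_k, v_l), and
    O is sesquilinear, so it vanishes if it does so on a basis
    ([O_defect_eq0]). *)

(** * Evaluation of polynomials with coefficients in a module *)

Lemma fssupp_uniq (S : pzRingType) (I : choiceType) (V : lmodType S)
  (p : fsfunct I V) : uniq (fssupp p).
Proof. exact: finite_support_uniq. Qed.

Section Evaluation.
Variable K : fieldType.
Local Notation A := {poly {poly K}}.

Definition peval (D : A) : {poly K} -> A :=
  horner_eval D \o map_poly (polyC \o polyC).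
HB.instance Definition _ D := GRing.RMorphism.on (peval D).

(** In {poly {poly K}} the outer variable 'X is sent to M and the inner one,
    'X%:P, to D. *)
Definition peval2 (D M : A) : A -> A := horner_eval M \o map_poly (peval D).
HB.instance Definition _ D M := GRing.RMorphism.on (peval2 D M).

Lemma pevalC D c : peval D c%:P = c%:P%:P.
Proof. by rewrite /peval /= map_polyC /horner_eval hornerC. Qed.

Lemma pevalX D : peval D 'X = D.
Proof. by rewrite /peval /= map_polyX /horner_eval hornerX. Qed.

Lemma pevalD D p q : peval D (p + q) = peval D p + peval D q.
Proof. exact: rmorphD. Qed.

Lemma pevalM D p q : peval D (p * q) = peval D p * peval D q.
Proof. exact: rmorphM. Qed.

(** Ring morphisms out of K[X] are determined by constants and by the image of
    the variable; all the compatibilities of [peval] come from this. *)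
Lemma eq_poly_rmorph (f g : {rmorphism {poly K} -> A}) :
  (forall c, f c%:P = g c%:P) -> f 'X = g 'X -> f =1 g.
Proof.
move=> fgC fgX; elim/poly_ind => [|p c IHp]; first by rewrite !rmorph0.
by rewrite !rmorphD !rmorphM IHp fgX fgC.
Qed.

Lemma peval_outer p : peval 'X%:P p = p%:P.
Proof.
apply: (eq_poly_rmorph (f := peval 'X%:P) (g := polyC)) => [c|].
  exact: pevalC.
exact: pevalX.
Qed.

Lemma peval_comp D p q : peval D (p \Po q) = peval (peval D q) p.
Proof.
apply: (eq_poly_rmorph (f := peval D \o comp_poly q) (g := peval _)) => [c|] /=.
  by rewrite comp_polyC !pevalC.
by rewrite comp_polyX pevalX.
Qed.

Lemma peval_compN D p : peval D (p \Po - 'X) = peval (- D) p.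
Proof. by rewrite peval_comp rmorphN /= pevalX. Qed.

Lemma peval2C D M p : peval2 D M p%:P = peval D p.
Proof. by rewrite /peval2 /= map_polyC /horner_eval hornerC. Qed.

Lemma peval2X D M : peval2 D M 'X = M.
Proof. by rewrite /peval2 /= map_polyX /horner_eval hornerX. Qed.

Lemma peval2_peval D M D' p : peval2 D M (peval D' p) = peval (peval2 D M D') p.
Proof.
apply: (eq_poly_rmorph (f := peval2 D M \o peval D') (g := peval _)) => [c|] /=.
  by rewrite !pevalC peval2C pevalC.
by rewrite !pevalX.
Qed.

Lemma peval2_sumN D M (J : Type) (r : seq J) (F : J -> A) :
  peval2 D M (- \sum_(j <- r) F j) = - \sum_(j <- r) peval2 D M (F j).
Proof. by rewrite rmorphN rmorph_sum. Qed.

Lemma peval2_XnM D M n P : peval2 D M ('X^n * P) = M ^+ n * peval2 D M P.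
Proof. by rewrite rmorphM rmorphXn /= peval2X. Qed.

Lemma peval2_YX D M : peval2 D M ('X%:P - 'X) = D - M.
Proof. by rewrite rmorphB /= peval2C pevalX peval2X. Qed.

End Evaluation.

(** The value at lambda = M and del = D of a polynomial in lambda with
    coefficients in U, seen through the functional al; for a K[del]-linear al
    it is a ring-valued substitute for the polynomial itself. *)
HB.lock Definition veval (K : fieldType) (U : lmodType {poly K})
    (al : U -> {poly K}) (D M : {poly {poly K}}) (p : {vpoly U}) :
    {poly {poly K}} :=
  \sum_(n <- fssupp p) M ^+ n * peval D (al (p n)).

Section VectorEvaluation.
Variable K : fieldType.
Local Notation A := {poly {poly K}}.
Variable U : lmodType {poly K}.
Implicit Types (al : U -> {poly K}) (p q : {vpoly U}) (D M : A).

Lemma scalar_fun0 al : scalar al -> al 0 = 0.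
Proof. by move=> /(_ (-1) 0 0); rewrite scaler0 addr0 mulN1r addNr. Qed.
Lemma scalar_funD al : scalar al -> forall x y, al (x + y) = al x + al y.
Proof. by move=> h x y; have := h 1 x y; rewrite scale1r mul1r. Qed.
Lemma scalar_funZ al : scalar al -> forall c x, al (c *: x) = c * al x.
Proof. by move=> h c x; have := h c x 0; rewrite (scalar_fun0 h) !addr0. Qed.
Lemma scalar_fun_sum al (J : Type) (r : seq J) (P : pred J) (F : J -> U) :
  scalar al -> al (\sum_(j <- r | P j) F j) = \sum_(j <- r | P j) al (F j).
Proof.
by move=> h; apply: (big_morph al); [exact: scalar_funD | exact: scalar_fun0].
Qed.

Lemma veval_big al D M p (s : seq nat) : al 0 = 0 ->
    uniq s -> {subset fssupp p <= s} ->
  veval al D M p = \sum_(n <- s) M ^+ n * peval D (al (p n)).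
Proof.
move=> h; rewrite veval.unlock.
apply: (big_fssupp (F := fun n u => M ^+ n * peval D (al u))) => n.
by rewrite h rmorph0 mulr0.
Qed.

Lemma veval_single al D M n u : al 0 = 0 ->
  veval al D M (fssingle n u) = M ^+ n * peval D (al u).
Proof.
move=> h; rewrite veval.unlock.
apply: (big_fssingle (F := fun n u => M ^+ n * peval D (al u))) => k.
by rewrite h rmorph0 mulr0.
Qed.

Lemma veval_const al D M u :
  al 0 = 0 -> veval al D M (vconst u) = peval D (al u).
Proof. by move=> h; rewrite veval_single // mul1r. Qed.

Variable al : U -> {poly K}.
Hypothesis h : scalar al.

Lemma vevalD D M p q : veval al D M (p + q) = veval al D M p + veval al D M q.
Proof.
rewrite veval.unlock.
apply: (big_fssuppD (F := fun n u => M ^+ n * peval D (al u))) => n.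
  by rewrite (scalar_fun0 h) rmorph0 mulr0.
by move=> u v; rewrite scalar_funD // rmorphD mulrDr.
Qed.

Lemma veval0 D M : veval al D M 0 = 0.
Proof. by rewrite veval.unlock big1_seq // => n; rewrite mem_fssupp eqxx. Qed.

Lemma veval_sum D M (J : Type) (r : seq J) (P : pred J) (F : J -> {vpoly U}) :
  veval al D M (\sum_(j <- r | P j) F j) =
  \sum_(j <- r | P j) veval al D M (F j).
Proof.
by apply: (big_morph (veval al D M)); [exact: vevalD | exact: veval0].
Qed.

Lemma vevalN D M p : veval al D M (- p) = - veval al D M p.
Proof. by apply/eqP; rewrite -addr_eq0 -vevalD addNr veval0. Qed.

Lemma vevalZ D M c p : veval al D M (c *: p) = peval D c * veval al D M p.
Proof.
rewrite (@veval_big _ _ _ (c *: p) (fssupp p)) ?fssupp_uniq ?scalar_fun0 //.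
  rewrite veval.unlock mulr_sumr; apply: eq_bigr => n _.
  by rewrite fsfunZE scalar_funZ // rmorphM mulrCA.
move=> n; rewrite !mem_fssupp; apply: contraNneq => p0.
by rewrite fsfunZE p0 scaler0.
Qed.

Lemma veval_del D M p : veval al D M (del p) = D * veval al D M p.
Proof. by rewrite vevalZ pevalX. Qed.

Lemma veval_vX D M p : veval al D M (vX p) = M * veval al D M p.
Proof.
rewrite /vX veval_sum [in RHS]veval.unlock mulr_sumr; apply: eq_bigr => n _.
by rewrite veval_single ?scalar_fun0 // exprS mulrA.
Qed.

(** As del acts as D, substituting - lambda - del for lambda turns M into
    - M - D. *)
Lemma veval_vflip D M p : veval al D M (vflip p) = veval al D (- M - D) p.
Proof.
rewrite /vflip /vsubst veval_sum [in RHS]veval.unlock; apply: eq_bigr => n _.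
elim: n (p n) => [|n IHn] u; first by rewrite veval_const ?scalar_fun0 // mul1r.
rewrite iterS vevalD !vevalN veval_vX veval_del IHn exprS.
by rewrite -mulrA mulrBl mulNr.
Qed.

(** The weights c j come out as peval D (c j) because they are polynomials in
    del. *)
Lemma veval_decomp (J : finType) (c : J -> {poly K})
    (io : J -> U -> {poly K}) D M p :
    (forall u, al u = \sum_j c j * io j u) ->
  veval al D M p = \sum_j peval D (c j) * veval (io j) D M p.
Proof.
move=> alE; rewrite veval.unlock; under [RHS]eq_bigr do rewrite mulr_sumr.
rewrite exchange_big /=; apply: eq_bigr => n _.
rewrite alE rmorph_sum mulr_sumr; apply: eq_bigr => j _.
by rewrite rmorphM mulrCA.
Qed.

Lemma veval_comb (c : {poly K}) (be ga : U -> {poly K}) D M p :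
    (forall u, al u = c * be u + ga u) ->
  veval al D M p = peval D c * veval be D M p + veval ga D M p.
Proof.
move=> alE; rewrite veval.unlock mulr_sumr -big_split; apply: eq_bigr => k _ /=.
by rewrite alE rmorphD rmorphM mulrDr mulrCA.
Qed.

End VectorEvaluation.

Section EvaluationOfMaps.
Variable K : fieldType.
Local Notation A := {poly {poly K}}.

Lemma veval_vmap (U U' : lmodType {poly K}) (f : U -> U') al D M p :
    f 0 = 0 -> scalar al ->
  veval al D M (vmap f p) = veval (al \o f) D M p.
Proof.
move=> f0 h; rewrite /vmap veval_sum // [in RHS]veval.unlock.
by apply: eq_bigr => n _; rewrite veval_single ?scalar_fun0.
Qed.

(** At the generic point D = 'X%:P, M = 'X the coefficient of 'X^n is the value
    of the functional on the n-th coefficient, so nothing is lost by evaluating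
    with enough functionals. *)
Lemma veval_inj (U : lmodType {poly K}) (J : Type)
    (io : J -> U -> {poly K}) (p q : {vpoly U}) :
    (forall j, io j 0 = 0) ->
    (forall x y, (forall j, io j x = io j y) -> x = y) ->
    (forall j, veval (io j) 'X%:P 'X p = veval (io j) 'X%:P 'X q) ->
  p = q.
Proof.
move=> io0 sep epq; apply: fsfunP => n; apply: sep => j.
have cf r : (veval (io j) 'X%:P 'X r)`_n = io j (r n).
  rewrite veval.unlock coef_sum.
  under eq_bigr do rewrite peval_outer mulrC coefCM coefXn.
  have [nr|/[dup] nr] := boolP (n \in fssupp r); last first.
    rewrite mem_fssupp negbK => /eqP ->; rewrite io0 big1_seq // => k kr.
    case: eqP => [nk|]; rewrite ?mulr0 //.
    by case/andP: kr nr; rewrite nk => _ ->.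
  rewrite (bigD1_seq n) ?fssupp_uniq //= eqxx mulr1 big1 ?addr0 //.
  by move=> k /negPf; rewrite eq_sym => ->; rewrite mulr0.
by rewrite -!cf epq.
Qed.

(** The case p = -1, x = y = 0. *)
Lemma peval_semilin0 (U : lmodType {poly K}) (g : U -> A) (D : A) :
    (forall p x y, g (p *: x + y) = peval D p * g x + g y) -> g 0 = 0.
Proof.
move=> gl; have := gl (-1) 0 0; rewrite scaler0 addr0 -polyCN pevalC.
by rewrite !polyCN !polyC1 mulN1r addNr.
Qed.

(** Compatibility with constants and with del gives compatibility with all of
    K[del]. *)
Lemma peval_semilin (U : lmodType {poly K}) (g : U -> A) (D : A) :
    (forall (c : K) x y, g (c%:P *: x + y) = c%:P%:P * g x + g y) ->
    (forall x, g (del x) = D * g x) ->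
  forall p x y, g (p *: x + y) = peval D p * g x + g y.
Proof.
move=> gl gd p x y.
have g0 : g 0 = 0.
  by have := gl (-1) 0 0; rewrite scaler0 addr0 !polyCN !polyC1 mulN1r addNr.
have gD u w : g (u + w) = g u + g w.
  by have := gl 1 u w; rewrite !polyC1 scale1r mul1r.
rewrite gD; congr (_ + _); elim/poly_ind: p => [|p c IHp].
  by rewrite scale0r g0 rmorph0 mul0r.
rewrite mulrC scalerDl -scalerA gD gd IHp pevalD pevalM pevalX pevalC.
rewrite mulrDl mulrA.
by congr (_ + _); have := gl c x 0; rewrite g0 !addr0.
Qed.

End EvaluationOfMaps.

(** * The dual representation as a transpose *)

Section Sesquilinear.
Variable K : fieldType.
Variables U V : lmodType {poly K}.
Variables (rho : U -> V -> {vpoly V}) (al : V -> {poly K}).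
Hypotheses (sr : conformal_sesquilinear rho) (h : scalar al).

(** The first axiom of sesquilinearity says that del in the first argument
    acts as - lambda, whose value is - M. *)
Lemma veval_linl D M p a b v :
  veval al D M (rho (p *: a + b) v) =
  peval (- M) p * veval al D M (rho a v) + veval al D M (rho b v).
Proof.
pose g a := veval al D M (rho a v).
move: p a b; apply: (@peval_semilin _ _ g) => [c x y|x]; rewrite /g.
  by rewrite (conf_linearl sr) vevalD // vevalZ // pevalC.
by rewrite (conf_dell sr) vevalN // veval_vX // mulNr.
Qed.

(** Here del in the second argument acts as del + lambda, of value D + M. *)
Lemma veval_linr D M p a u v :
  veval al D M (rho a (p *: u + v)) =
  peval (D + M) p * veval al D M (rho a u) + veval al D M (rho a v).
Proof.
pose g v := veval al D M (rho a v).
move: p u v; apply: (@peval_semilin _ _ g) => [c x y|x]; rewrite /g.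
  by rewrite (conf_linearr sr) vevalD // vevalZ // pevalC.
by rewrite (conf_delr sr) vevalD // veval_del // veval_vX // mulrDl.
Qed.
End Sesquilinear.

Section DualBasis.
Variable K : fieldType.
Variable V : lmodType {poly K}.
Variables (m : nat) (v : 'I_m -> V) (vs : 'I_m -> cdual V).
Hypotheses (hv : is_basis v) (hvs : forall i k, vs i (v k) = (i == k)%:R).

Lemma comp_polyNXK (p : {poly K}) : (p \Po - 'X) \Po - 'X = p.
Proof.
have NX : - 'X \Po - 'X = 'X :> {poly K} by rewrite raddfN /= comp_polyX opprK.
by rewrite -comp_polyA NX comp_polyXr.
Qed.

Lemma cdual_scalar (f : cdual V) : scalar f.
Proof. by move=> p x y; rewrite cdual_linear. Qed.

Lemma cdualDZE p (f g : cdual V) w :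
  (p *: f + g : cdual V) w = (p \Po - 'X) * f w + g w.
Proof. by []. Qed.

Lemma vs_decomp w : w = \sum_i vs i w *: v i.
Proof.
have [c [-> _]] := hv w; apply: eq_bigr => i _; congr (_ *: _).
rewrite scalar_fun_sum; last exact: cdual_scalar.
rewrite (bigD1 i) //= big1 ?addr0 => [|k ki].
  by rewrite (scalar_funZ (@cdual_scalar _)) hvs eqxx mulr1.
by rewrite (scalar_funZ (@cdual_scalar _)) hvs eq_sym (negPf ki) mulr0.
Qed.

(** The coordinates on V^*c in the basis dual to v.  The composition with - 'X
    is there because del acts on f_lambda as the multiplication by
    - lambda. *)
Definition dcoord i (f : cdual V) : {poly K} := f (v i) \Po - 'X.

Lemma dcoord_scalar i : scalar (dcoord i).
Proof.
move=> p f g; rewrite /dcoord cdualDZE.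
by rewrite comp_polyD comp_polyM comp_polyNXK.
Qed.

Lemma dcoord_vs i k : dcoord i (vs k) = (k == i)%:R.
Proof. by rewrite /dcoord hvs rmorph_nat. Qed.

Lemma cdual_decomp f : f = \sum_i dcoord i f *: vs i.
Proof.
apply/val_inj/funext => w /=.
have sumE (F : 'I_m -> cdual V) : (\sum_i F i) w = \sum_i F i w.
  by elim/big_rec2: _ => // i y1 y2 _ <-.
rewrite sumE {1}[w]vs_decomp (scalar_fun_sum _ _ _ (@cdual_scalar f)).
apply: eq_bigr => i _; rewrite (scalar_funZ (@cdual_scalar f)) mulrC cdualZE.
by rewrite comp_polyNXK.
Qed.

Lemma veval_cdual (be : cdual V -> {poly K}) D M p : scalar be ->
  veval be D M p = \sum_i peval D (be (vs i)) * veval (dcoord i) D M p.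
Proof.
move=> h; apply: veval_decomp => f.
rewrite {1}[f]cdual_decomp scalar_fun_sum //.
by apply: eq_bigr => i _; rewrite scalar_funZ // mulrC.
Qed.

Section DualRep.
Variables (R : lmodType {poly K}) (rho : R -> V -> {vpoly V}).
Hypothesis sr : conformal_sesquilinear rho.

(** With the variable of f at nu = - D, as in [dcoord], and lambda = M, the
    defining formula - f_(nu - lambda)(rho(a)_lambda v_i) has nu - lambda equal
    to - D - M. *)
Lemma veval_dcoord_dual_rep i D M a f :
  veval (dcoord i) D M (dual_rep rho a f) = - veval f (- D - M) M (rho a (v i)).
Proof.
have vgen x : exists c : 'I_m -> {poly K}, x = \sum_i c i *: v i.
  by exists (fun i => vs i x); apply: vs_decomp.
pose P := dual_rep_poly rho a f (v i).
have PE : P = - \sum_(n <- fssupp (rho a (v i)))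
    'X^n * peval ('X%:P - 'X) (f (rho a (v i) n)) by [].
have -> : - veval f (- D - M) M (rho a (v i)) = peval2 (- D) M P.
  rewrite PE peval2_sumN veval.unlock; apply: (congr1 -%R).
  apply: eq_bigr => n _.
  by rewrite peval2_XnM peval2_peval peval2_YX.
(* A common bound for the degrees in lambda on both sides. *)
pose s := iota 0 (maxn (size P) (\max_(k <- fssupp (dual_rep rho a f)) k).+1).
rewrite (@veval_big _ _ _ _ _ _ s) ?iota_uniq //; last 2 first.
- exact/scalar_fun0/dcoord_scalar.
- move=> k ks; rewrite mem_iota add0n leq_max ltnS.
  by apply/orP; right; apply: (@leq_bigmax_seq _ _ xpredT id).
rewrite /peval2 /= /horner_eval (@horner_coef_wide _ (maxn (size P)
    (\max_(k <- fssupp (dual_rep rho a f)) k).+1)); last first.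
  by rewrite (leq_trans (size_poly _ _)) // leq_maxl.
rewrite /s -{1}[maxn _ _]subn0 big_mkord; apply: eq_bigr => k _.
by rewrite coef_map /= mulrC /dcoord (dual_repE sr vgen) peval_compN.
Qed.

(** The transpose of rho(a), paired with f and be through the dual bases. *)
Definition dual_action (be : cdual V -> {poly K}) D M a (f : cdual V) :=
  \sum_i peval D (be (vs i)) * veval f (- D - M) M (rho a (v i)).

Lemma veval_dual_rep be D M a f : scalar be ->
  veval be D M (dual_rep rho a f) = - dual_action be D M a f.
Proof.
move=> h; rewrite veval_cdual // -sumrN; apply: eq_bigr => i _.
by rewrite veval_dcoord_dual_rep mulrN.
Qed.

Lemma dual_action_linl be D M p a b f :
  dual_action be D M (p *: a + b) f =
  peval (- M) p * dual_action be D M a f + dual_action be D M b f.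
Proof.
rewrite /dual_action mulr_sumr -big_split /=; apply: eq_bigr => i _.
rewrite (veval_linl sr (@cdual_scalar f)) mulrDr; congr (_ + _); exact: mulrCA.
Qed.

Lemma dual_action_linr be D M p a f g :
  dual_action be D M a (p *: f + g) =
  peval (D + M) p * dual_action be D M a f + dual_action be D M a g.
Proof.
rewrite /dual_action mulr_sumr -big_split /=; apply: eq_bigr => i _.
rewrite [peval (D + M) p * _]mulrCA -mulrDr; congr (_ * _).
rewrite (veval_comb _ _ _ (cdualDZE p f g)) peval_compN.
congr (peval _ _ * _ + _).
by rewrite opprB opprK addrC.
Qed.

Section Semidirect.
Variable br : R -> R -> {vpoly R}.
Hypothesis sb : conformal_sesquilinear br.
Local Notation L := (R * cdual V)%type.

Definition restr_l (al : L -> {poly K}) x := al (x, 0).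
Definition restr_r (al : L -> {poly K}) f := al (0, f).

Lemma inl_linear p (x y : R) :
  (p *: x + y, 0 : cdual V) = p *: (x, 0) + (y, 0) :> L.
Proof. by congr (_, _); rewrite /= scaler0 addr0. Qed.
Lemma inr_linear p (x y : cdual V) :
  (0 : R, p *: x + y) = p *: (0, x) + (0, y) :> L.
Proof. by congr (_, _); rewrite /= scaler0 addr0. Qed.

Lemma restr_l_scalar al : scalar al -> scalar (restr_l al).
Proof. by move=> h p x y; rewrite /restr_l inl_linear h. Qed.
Lemma restr_r_scalar al : scalar al -> scalar (restr_r al).
Proof. by move=> h p x y; rewrite /restr_r inr_linear h. Qed.

(** The bracket of the semi-direct sum, with the dual representation replaced by
    its transpose; see [veval_semidirect]. *)
Definition bracket_eval al D M (x y : L) : {poly {poly K}} :=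
  veval (restr_l al) D M (br x.1 y.1) - dual_action (restr_r al) D M x.1 y.2
   + dual_action (restr_r al) D (- M - D) y.1 x.2.

Lemma veval_semidirect al D M (x y : L) : scalar al ->
  veval al D M (semidirect_bracket rho br x y) = bracket_eval al D M x y.
Proof.
move=> h; have hr := restr_r_scalar h.
rewrite /semidirect_bracket vevalD // veval_vmap // veval_vmap //.
rewrite vevalD // vevalN // veval_vflip //.
by rewrite veval_dual_rep // veval_dual_rep // opprK addrA.
Qed.

Lemma bracket_eval_linl al D M p (x x' y : L) : scalar al ->
  bracket_eval al D M (p *: x + x') y =
  peval (- M) p * bracket_eval al D M x y + bracket_eval al D M x' y.
Proof.
move=> h; rewrite /bracket_eval (veval_linl sb (restr_l_scalar h)).
rewrite dual_action_linl dual_action_linr.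
have -> : D + (- M - D) = - M by ring.
ring.
Qed.

Lemma bracket_eval_linr al D M p (x y y' : L) : scalar al ->
  bracket_eval al D M x (p *: y + y') =
  peval (D + M) p * bracket_eval al D M x y + bracket_eval al D M x y'.
Proof.
move=> h; rewrite /bracket_eval (veval_linr sb (restr_l_scalar h)).
rewrite dual_action_linl dual_action_linr.
have -> : - (- M - D) = D + M by ring.
ring.
Qed.
End Semidirect.
End DualRep.
End DualBasis.

(** * The Yang-Baxter expression on functionals *)

Section CybeTerm.
Variables (K : fieldType) (L : lmodType {poly K}).
Local Notation A := {poly {poly K}}.
Variable B : (L -> {poly K}) -> A -> A -> L -> L -> A.
Variables (al be ga : L -> {poly K}) (D1 D2 D3 : A).

(** The summand of the Yang-Baxter expression for the pairs p and q, seen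
    through al (x) be (x) ga, where B al D M x y stands for the value of the
    bracket of x and y through al at lambda = M and del = D. *)
Definition cybe_term (p q : L * L) : A :=
  B al D1 D2 p.1 q.1 * peval D2 (be p.2) * peval D3 (ga q.2)
  - peval D1 (al p.1) * B be D2 D3 q.1 p.2 * peval D3 (ga q.2)
  - peval D1 (al p.1) * peval D2 (be q.1) * B ga D3 D2 q.2 p.2.

Definition semilinear_bracket := forall al D M, scalar al ->
  (forall p x x' y, B al D M (p *: x + x') y =
     peval (- M) p * B al D M x y + B al D M x' y) /\
  (forall p x y y', B al D M x (p *: y + y') =
     peval (D + M) p * B al D M x y + B al D M x y').

(** The bilinear forms on L that vanish on the image of
    del (x) 1 + 1 (x) del. *)
Definition balanced (F : L -> L -> A) :=
  [/\ forall (c : K) x x' y, F (c%:P *: x + x') y = c%:P%:P * F x y + F x' y,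
      forall (c : K) x y y', F x (c%:P *: y + y') = c%:P%:P * F x y + F x y' &
      forall x y, F (del x) y + F x (del y) = 0].

Hypothesis hB : semilinear_bracket.
Hypotheses (hal : scalar al) (hbe : scalar be) (hga : scalar ga).
Hypothesis D123 : D1 + D2 + D3 = 0.

Lemma balanced_semilin (F : L -> L -> A) (D : A) :
    (forall p x x' y, F (p *: x + x') y = peval D p * F x y + F x' y) ->
    (forall p x y y', F x (p *: y + y') = peval (- D) p * F x y + F x y') ->
  balanced F.
Proof.
move=> Fl Fr; split=> [c x x' y|c x y y'|x y].
- by rewrite Fl pevalC.
- by rewrite Fr pevalC.
have F0l : F 0 y = 0.
  exact: (peval_semilin0 (g := F^~ y) (fun p u w => Fl p u w y)).
have F0r : F x 0 = 0.
  exact: (peval_semilin0 (fun p u w => Fr p x u w)).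
have := Fl 'X x 0 y; have := Fr 'X x y 0.
by rewrite !addr0 F0l F0r !addr0 !pevalX => -> ->; rewrite mulNr addrN.
Qed.

Lemma balancedB F G : balanced F -> balanced G ->
  balanced (fun x y => F x y - G x y).
Proof.
move=> [Fl Fr Fd] [Gl Gr Gd]; split=> [c x x' y|c x y y'|x y].
- by rewrite Fl Gl; ring.
- by rewrite Fr Gr; ring.
by rewrite addrACA -opprD Fd Gd subrr.
Qed.

(** On the entries of the first pair, del acts as - D2 and D2 in the first
    term, and as D1 and D2 + D3 = - D1 in the other two. *)
Lemma cybe_term_balanced_l q : balanced (fun x y => cybe_term (x, y) q).
Proof.
have [Bal _] := hB D1 D2 hal; have [_ Bbe] := hB D2 D3 hbe.
have [_ Bga] := hB D3 D2 hga.
have D23 : D2 + D3 = - D1 by apply/eqP; rewrite -addr_eq0 addrC addrA D123.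
have D32 : D3 + D2 = - D1 by rewrite addrC.
apply: balancedB; first apply: balancedB.
- apply: (@balanced_semilin _ (- D2)) => p x y z /=; rewrite ?opprK.
    by rewrite Bal; ring.
  by rewrite hbe pevalD pevalM; ring.
- apply: (@balanced_semilin _ D1) => p x y z /=.
    by rewrite hal pevalD pevalM; ring.
  by rewrite Bbe D23; ring.
apply: (@balanced_semilin _ D1) => p x y z /=.
  by rewrite hal pevalD pevalM; ring.
by rewrite Bga D32; ring.
Qed.

(** On the entries of the second pair, del acts as D1 + D2 = - D3 and D3 in the
    first term, as - D3 and D3 in the second, as D2 and - D2 in the third. *)
Lemma cybe_term_balanced_r p : balanced (fun x y => cybe_term p (x, y)).
Proof.
have [_ Bal] := hB D1 D2 hal; have [Bbe _] := hB D2 D3 hbe.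
have [Bga _] := hB D3 D2 hga.
have D12 : D1 + D2 = - D3 by apply/eqP; rewrite -addr_eq0 D123.
apply: balancedB; first apply: balancedB.
- apply: (@balanced_semilin _ (- D3)) => c x y z /=; rewrite ?opprK.
    by rewrite Bal D12; ring.
  by rewrite hga pevalD pevalM; ring.
- apply: (@balanced_semilin _ (- D3)) => c x y z /=; rewrite ?opprK.
    by rewrite Bbe; ring.
  by rewrite hga pevalD pevalM; ring.
apply: (@balanced_semilin _ D2) => c x y z /=.
  by rewrite hbe pevalD pevalM; ring.
by rewrite Bga; ring.
Qed.
End CybeTerm.

Section MixedComponents.
Variables (K : fieldType) (R V : lmodType {poly K}).
Local Notation A := {poly {poly K}}.
Local Notation L := (R * cdual V)%type.
Variables (m : nat) (v : 'I_m -> V) (vs : 'I_m -> cdual V).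
Variables (br : R -> R -> {vpoly R}) (rho : R -> V -> {vpoly V}).
Hypothesis sb : conformal_sesquilinear br.
Hypothesis sr : conformal_sesquilinear rho.
Hypothesis skew : forall a b, br a b = - vflip (br b a).
Local Notation act := (dual_action v vs rho).
Local Notation B := (bracket_eval v vs rho br).

Lemma sesquilinear0l (U W : lmodType {poly K}) (r : U -> W -> {vpoly W}) w :
  conformal_sesquilinear r -> r 0 w = 0.
Proof.
move=> s; have := conf_linearl s (-1) 0 0 w.
by rewrite scaler0 addr0 polyCN scaleN1r addNr.
Qed.

Lemma sesquilinear0r (U W : lmodType {poly K}) (r : U -> W -> {vpoly W}) u :
  conformal_sesquilinear r -> r u 0 = 0.
Proof.
move=> s; have := conf_linearr s (-1) u 0 0.
by rewrite scaler0 addr0 polyCN scaleN1r addNr.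
Qed.

Lemma dual_action0l be D M f : act be D M 0 f = 0.
Proof.
exact: (peval_semilin0 (fun p a b => dual_action_linl v vs sr be D M p a b f)).
Qed.

Lemma dual_action0r be D M a : act be D M a 0 = 0.
Proof.
exact: (peval_semilin0 (fun p => dual_action_linr v vs rho be D M p a)).
Qed.

Section Brackets.
Variables (al : L -> {poly K}) (D M : A).
Hypothesis h : scalar al.

Lemma bracket_eval_ll x y :
  B al D M (x, 0) (y, 0) = veval (restr_l al) D M (br x y).
Proof. by rewrite /bracket_eval /= !dual_action0r subr0 addr0. Qed.

Lemma bracket_eval_lr x f : B al D M (x, 0) (0, f) = - act (restr_r al) D M x f.
Proof.
by rewrite /bracket_eval /= sesquilinear0r // veval0 dual_action0l sub0r addr0.
Qed.

Lemma bracket_eval_rl x f :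
  B al D M (0, f) (x, 0) = act (restr_r al) D (- M - D) x f.
Proof.
by rewrite /bracket_eval /= sesquilinear0l // veval0 dual_action0l subr0 add0r.
Qed.

Lemma bracket_eval_rr f g : B al D M (0, f) (0, g) = 0.
Proof.
rewrite /bracket_eval /= sesquilinear0l // veval0 !dual_action0l.
by rewrite subr0 addr0.
Qed.
End Brackets.

Variable t : 'I_m -> R.

(** The component in R (x) V^*c (x) V^*c of the Yang-Baxter expression of the
    skew-symmetrization of the sum of the t i (x) vs i. *)
Definition cybe_RVV (al : R -> {poly K}) (be ga : cdual V -> {poly K})
    (D1 D2 D3 : A) : A :=
  \sum_i \sum_j
  (veval al D1 D2 (br (t i) (t j)) * peval D2 (be (vs i)) * peval D3 (ga (vs j))
   + peval D1 (al (t i)) * act be D2 D3 (t j) (vs i) * peval D3 (ga (vs j))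
   - peval D1 (al (t i)) * peval D2 (be (vs j)) * act ga D3 D2 (t j) (vs i)).

(** Each bracket lies in R or in V^*c, and a term whose bracket is nonzero has
    exactly one of its three factors in R; the place of this factor gives the
    three components.  By the skew-symmetry of br and D1 + D2 + D3 = 0, those
    with R in the second or third place are, up to sign, the first one with
    the factors permuted. *)
Lemma cybe_term_split al be ga D1 D2 D3 :
    scalar al -> scalar be -> scalar ga -> D1 + D2 + D3 = 0 ->
  let tl i := ((t i, 0), (0, vs i)) : L * L in
  let tr i := ((0, vs i), (t i, 0)) : L * L in
  let e := cybe_term B al be ga D1 D2 D3 in
  \sum_i \sum_j (e (tl i) (tl j) - e (tl i) (tr j)
                 - (e (tr i) (tl j) - e (tr i) (tr j))) =
  cybe_RVV (restr_l al) (restr_r be) (restr_r ga) D1 D2 D3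
  - cybe_RVV (restr_l be) (restr_r al) (restr_r ga) D2 D1 D3
  + cybe_RVV (restr_l ga) (restr_r al) (restr_r be) D3 D1 D2.
Proof.
move=> ha hb hg D123 tl tr e.
have D21 : - D2 - D1 = D3.
  by apply/eqP; rewrite eq_sym -subr_eq0 -D123; apply/eqP; ring.
have D32 : - D3 - D2 = D1.
  by apply/eqP; rewrite eq_sym -subr_eq0 -D123; apply/eqP; ring.
have D23 : - D2 - D3 = D1 by rewrite -D32 addrC.
have veval_skew x D M a b : scalar x ->
    veval x D M (br a b) = - veval x D (- M - D) (br b a).
  by move=> hx; rewrite skew vevalN // veval_vflip.
have hbl := restr_l_scalar hb; have hgl := restr_l_scalar hg.
(* P and Q collect the terms of the right-hand side, those of Q being indexed
   by (j, i) on the left. *)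
pose a' i D := peval D (restr_r al (vs i)).
pose b' i D := peval D (restr_r be (vs i)).
pose c' i D := peval D (restr_r ga (vs i)).
pose P i j :=
  veval (restr_l al) D1 D2 (br (t i) (t j)) * b' i D2 * c' j D3
  + peval D1 (restr_l al (t i)) * act (restr_r be) D2 D3 (t j) (vs i) * c' j D3
  - peval D1 (restr_l al (t i)) * b' j D2 * act (restr_r ga) D3 D2 (t j) (vs i)
  - veval (restr_l be) D2 D1 (br (t i) (t j)) * a' i D1 * c' j D3
  - peval D2 (restr_l be (t i)) * act (restr_r al) D1 D3 (t j) (vs i) * c' j D3
  + veval (restr_l ga) D3 D1 (br (t i) (t j)) * a' i D1 * b' j D2.
pose Q i j :=
  peval D2 (restr_l be (t i)) * a' j D1 * act (restr_r ga) D3 D1 (t j) (vs i)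
  + peval D3 (restr_l ga (t i)) * act (restr_r al) D1 D2 (t j) (vs i) * b' j D2
  - peval D3 (restr_l ga (t i)) * a' j D1 * act (restr_r be) D2 D1 (t j) (vs i).
transitivity (\sum_i \sum_j (P i j + Q j i)).
  apply: eq_bigr => i _; apply: eq_bigr => j _.
  rewrite /e /cybe_term /tl /tr /= !bracket_eval_ll !bracket_eval_lr.
  rewrite !bracket_eval_rl !bracket_eval_rr.
  rewrite D21 D32 D23.
  rewrite (veval_skew _ D2 D3 (t j)) // (veval_skew _ D3 D2 (t j)) // D32 D23.
  rewrite /P /Q /a' /b' /c' /restr_l /restr_r.
  ring.
transitivity (\sum_i \sum_j (P i j + Q i j)).
  under eq_bigr do rewrite big_split /=.
  rewrite big_split /= [X in _ + X]exchange_big -big_split /=.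
  by apply: eq_bigr => i _; rewrite -big_split.
rewrite /cybe_RVV -sumrN -!big_split; apply: eq_bigr => i _ /=.
rewrite -sumrN -!big_split; apply: eq_bigr => j _ /=.
rewrite /P /Q /a' /b' /c'; ring.
Qed.
End MixedComponents.

(** * The defect of an O-operator *)

Section Defect.
Variables (K : fieldType) (R V : lmodType {poly K}).
Local Notation A := {poly {poly K}}.
Variables (m : nat) (v : 'I_m -> V) (vs : 'I_m -> cdual V).
Hypotheses (hv : is_basis v) (hvs : forall i k, vs i (v k) = (i == k)%:R).
Variables (br : R -> R -> {vpoly R}) (rho : R -> V -> {vpoly V}).
Hypothesis sb : conformal_sesquilinear br.
Hypothesis sr : conformal_sesquilinear rho.
Variable T : V -> R.
Hypothesis linT : linear T.

Definition O_defect u w : {vpoly R} :=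
  br (T u) (T w) - vmap T (rho (T u) w - vflip (rho (T w) u)).

Let T0 : T 0 = 0.
Proof. by have := linT (-1) 0 0; rewrite scaler0 addr0 scaleN1r addNr. Qed.

Section DefectForm.
Variable al : R -> {poly K}.
Hypothesis h : scalar al.

Let hT : scalar (al \o T).
Proof. by move=> p x y /=; rewrite linT h. Qed.

(** Evaluated through al, the outer T of the O-operator identity is absorbed in
    the functional, and the flip is the replacement of M by - M - D. *)
Definition defect_form D M u w :=
  veval al D M (br (T u) (T w)) - veval (al \o T) D M (rho (T u) w)
  + veval (al \o T) D (- M - D) (rho (T w) u).

Lemma veval_defect D M u w : veval al D M (O_defect u w) = defect_form D M u w.
Proof.
rewrite /O_defect vevalD // vevalN // veval_vmap //.
rewrite vevalD // vevalN // veval_vflip //.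
by rewrite opprB addrA addrAC.
Qed.

Lemma defect_form_linl D M p u u' w :
  defect_form D M (p *: u + u') w =
  peval (- M) p * defect_form D M u w + defect_form D M u' w.
Proof.
rewrite /defect_form linT (veval_linl sb h).
rewrite (veval_linl sr hT) (veval_linr sr hT).
have -> : D + (- M - D) = - M by ring.
ring.
Qed.

Lemma defect_form_linr D M p u w w' :
  defect_form D M u (p *: w + w') =
  peval (D + M) p * defect_form D M u w + defect_form D M u w'.
Proof.
rewrite /defect_form linT (veval_linr sb h).
rewrite (veval_linl sr hT) (veval_linr sr hT).
have -> : - (- M - D) = D + M by ring.
ring.
Qed.

Lemma veval_comp_T D M q :
  veval (al \o T) D M q = \sum_i peval D (al (T (v i))) * veval (vs i) D M q.
Proof.
apply: veval_decomp => w /=; rewrite {1}[w](vs_decomp hv hvs).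
have -> : T (\sum_i vs i w *: v i) = \sum_i vs i w *: T (v i).
  elim/big_rec2: _ => // i y1 y2 _ <-; exact: linT.
rewrite scalar_fun_sum //; apply: eq_bigr => i _.
by rewrite scalar_funZ // mulrC.
Qed.

(** Summing al(T v_i)(D1) v_i^* over i gives al o T ([veval_comp_T]), which
    undoes the transposition of rho in the last two terms of [cybe_RVV]; they
    become the two terms of the right-hand side of the O-operator identity. *)
Lemma cybe_RVV_defect (be ga : cdual V -> {poly K}) D1 D2 D3 :
    D1 + D2 + D3 = 0 ->
  cybe_RVV v vs br rho (T \o v) al be ga D1 D2 D3 =
  \sum_i \sum_j peval D2 (be (vs i)) * peval D3 (ga (vs j)) *
    veval al D1 D2 (O_defect (v i) (v j)).
Proof.
move=> D123.
have D21 : - D2 - D1 = D3.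
  by apply/eqP; rewrite eq_sym -subr_eq0 -D123; apply/eqP; ring.
have D32 : - D3 - D2 = D1.
  by apply/eqP; rewrite eq_sym -subr_eq0 -D123; apply/eqP; ring.
have D23 : - D2 - D3 = D1 by rewrite -D32 addrC.
pose b i := peval D2 (be (vs i)); pose c i := peval D3 (ga (vs i)).
pose t i := peval D1 (al (T (v i))).
transitivity (\sum_i \sum_j (b i * c j * veval al D1 D2 (br (T (v i)) (T (v j)))
    + b i * c j * veval (al \o T) D1 D3 (rho (T (v j)) (v i))
    - b i * c j * veval (al \o T) D1 D2 (rho (T (v i)) (v j)))); last first.
  apply: eq_bigr => i _; apply: eq_bigr => j _.
  rewrite veval_defect /defect_form D21 /b /c; ring.
have splitE (F1 F2 F3 : 'I_m -> 'I_m -> A) :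
    \sum_i \sum_j (F1 i j + F2 i j - F3 i j) =
    \sum_i \sum_j F1 i j + \sum_i \sum_j F2 i j - \sum_i \sum_j F3 i j.
  rewrite -sumrN -!big_split; apply: eq_bigr => i _ /=.
  by rewrite -sumrN -!big_split.
rewrite /cybe_RVV !splitE /=; congr (_ + _ - _).
- apply: eq_bigr => i _; apply: eq_bigr => j _; rewrite /b /c; ring.
- transitivity (\sum_i \sum_k \sum_j
      b k * c j * (t i * veval (vs i) D1 D3 (rho (T (v j)) (v k)))).
    apply: eq_bigr => i _; rewrite [RHS]exchange_big; apply: eq_bigr => j _ /=.
    rewrite /dual_action D23 mulr_sumr mulr_suml; apply: eq_bigr => k _.
    rewrite /b /c /t; ring.
  rewrite exchange_big /=; apply: eq_bigr => k _.
  rewrite exchange_big /=; apply: eq_bigr => j _.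
  by rewrite veval_comp_T -mulr_sumr.
transitivity (\sum_i \sum_j \sum_k
    b j * c k * (t i * veval (vs i) D1 D2 (rho (T (v j)) (v k)))).
  apply: eq_bigr => i _; apply: eq_bigr => j _.
  rewrite /dual_action D32 mulr_sumr; apply: eq_bigr => k _.
  rewrite /b /c /t; ring.
rewrite exchange_big /=; apply: eq_bigr => j _.
rewrite exchange_big /=; apply: eq_bigr => k _.
by rewrite veval_comp_T -mulr_sumr.
Qed.
End DefectForm.

Lemma semilin_eq0 (g : V -> A) (D : A) :
    (forall p u u', g (p *: u + u') = peval D p * g u + g u') ->
    (forall i, g (v i) = 0) ->
  forall u, g u = 0.
Proof.
move=> gl g0 u; have g00 := peval_semilin0 gl.
rewrite [u](vs_decomp hv hvs); elim/big_rec: _ => // i y _ gy.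
by rewrite gl g0 gy mulr0 addr0.
Qed.

(** The defect is sesquilinear: at the generic point it is K[del]-semilinear in
    each argument, with del acting as - lambda and as del + lambda. *)
Lemma O_defect_eq0 n (e : 'I_n -> R) (es : 'I_n -> cdual R) :
    is_basis e -> (forall i k, es i (e k) = (i == k)%:R) ->
    (forall i j, O_defect (v i) (v j) = 0) ->
  forall u w, O_defect u w = 0.
Proof.
move=> he hes d0 u w.
apply: (@veval_inj _ _ _ (fun j => es j : R -> {poly K})) => [j|x y exy|j].
- exact/scalar_fun0/cdual_scalar.
- rewrite [x](vs_decomp he hes) [y](vs_decomp he hes).
  by apply: eq_bigr => j _; rewrite exy.
have h := @cdual_scalar _ _ (es j); rewrite veval0 // veval_defect //.
move: u; apply: (semilin_eq0 (D := - 'X)) => [p x y|i].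
  exact: defect_form_linl.
move: w; apply: (semilin_eq0 (D := 'X%:P + 'X)) => [p x y|k].
  exact: defect_form_linr.
by rewrite -veval_defect // d0 veval0.
Qed.
End Defect.

Lemma dual_basis_exists (K : fieldType) (R : lmodType {poly K}) n
    (e : 'I_n -> R) :
  is_basis e ->
  exists es : 'I_n -> cdual R, forall i k, es i (e k) = (i == k)%:R.
Proof.
move=> he; pose c x : {ffun 'I_n -> {poly K}} := projT1 (cid (he x)).
have cE x : x = \sum_j c x j *: e j by rewrite /c; case: cid => /= ? [].
have cU x (d : {ffun 'I_n -> {poly K}}) : x = \sum_j d j *: e j -> c x = d.
  by rewrite /c; case: cid => /= ? [_ uq] /uq.
have cl p x y : c (p *: x + y) = [ffun j => p * c x j + c y j].
  apply: cU; rewrite {1}[x]cE {1}[y]cE scaler_sumr -big_split.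
  by apply: eq_bigr => j _; rewrite ffunE scalerDl scalerA.
have c0 : c 0 = [ffun=> 0].
  by apply: cU; rewrite big1 // => i _; rewrite ffunE scale0r.
have cP j : (fun x => c x j) \in @is_cdual _ R.
  apply/asboolP; split=> [a x y|x]; first by rewrite cl ffunE mul_polyC.
  by have := cl 'X x 0; rewrite addr0 => ->; rewrite ffunE c0 ffunE addr0.
exists (fun j => CDual (cP j)) => i k /=.
rewrite (cU (e k) [ffun j => (j == k)%:R]) ?ffunE //.
rewrite (bigD1 k) //= ffunE eqxx scale1r big1 ?addr0 // => j jk.
by rewrite ffunE (negPf jk) scale0r.
Qed.

(** * Tensor products and bilinear forms *)

Section TensorExtra.
Variable K : fieldType.
Local Notation A := {poly {poly K}}.

Section Maps.
Variables (A1 A2 B1 B2 : lmodType K) (f : A1 -> B1) (g : A2 -> B2).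
Hypotheses (hf : linear f) (hg : linear g).

Let tl b : linear (fun a => tens (f a) (g b)).
Proof. by move=> c x y; rewrite hf tens_linearl. Qed.
Let tr a : linear (fun b => tens (f a) (g b)).
Proof. by move=> c x y; rewrite hg tens_linearr. Qed.

Lemma tmap_tens a b : tmap f g (tens a b) = tens (f a) (g b).
Proof. exact: tlift_tens. Qed.

Lemma tmap_linear : linear (tmap f g).
Proof. exact: tlift_linear. Qed.
End Maps.

Lemma tflip_tens (A1 A2 : lmodType K) (a : A1) (b : A2) :
  tflip (tens a b) = tens b a.
Proof.
apply: (tlift_tens (phi := fun a b => tens b a)) => x.
  exact: tens_linearr.
exact: tens_linearl.
Qed.

Lemma tflip_linear (A1 A2 : lmodType K) : linear (@tflip K A1 A2).
Proof.
apply: (tlift_linear (phi := fun a b => tens b a)) => x.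
  exact: tens_linearr.
exact: tens_linearl.
Qed.

Section LinearFacts.
Variables (U W : lmodType K) (f : U -> W).
Hypothesis hf : linear f.
Lemma lin0 : f 0 = 0.
Proof. by have := hf (-1) 0 0; rewrite scaler0 addr0 scaleN1r addNr. Qed.
Lemma linD x y : f (x + y) = f x + f y.
Proof. by have := hf 1 x y; rewrite !scale1r. Qed.
Lemma linN x : f (- x) = - f x.
Proof. by apply/eqP; rewrite -addr_eq0 -linD addNr lin0. Qed.
Lemma linB x y : f (x - y) = f x - f y.
Proof. by rewrite linD linN. Qed.
Lemma linZ c x : f (c *: x) = c *: f x.
Proof. by have := hf c x 0; rewrite !addr0 lin0 addr0. Qed.
Lemma lin_sum (J : Type) (r : seq J) (P : pred J) (F : J -> U) :
  f (\sum_(j <- r | P j) F j) = \sum_(j <- r | P j) f (F j).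
Proof. exact: (big_morph f linD lin0). Qed.
End LinearFacts.

Lemma linear_add (U W : lmodType K) (f g : U -> W) :
  linear f -> linear g -> linear (fun x => f x + g x).
Proof. by move=> hf hg c x y; rewrite hf hg scalerDr addrACA. Qed.

Lemma tensor_ind (A1 A2 : lmodType K) (P : tensor A1 A2 -> Prop) :
    P 0 -> (forall x y, P x -> P y -> P (x + y)) ->
    (forall a b, P (tens a b)) -> forall t, P t.
Proof.
move=> P0 PD PT t; have [s ->] := tensor_span t.
by elim/big_ind: _ => // i _; apply: PT.
Qed.

Lemma linear_comp (U U' W : lmodType K) (f : U -> U') (g : U' -> W) :
  linear f -> linear g -> linear (fun x => g (f x)).
Proof. by move=> hf hg c x y; rewrite hf hg. Qed.

Lemma linear_tens_eq0 (A1 A2 W : lmodType K) (f : tensor A1 A2 -> W) :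
  linear f -> (forall a b, f (tens a b) = 0) -> forall t, f t = 0.
Proof.
move=> hf f0 t; elim/tensor_ind: t => [|x y fx fy|//].
  exact: lin0.
by rewrite linD // fx fy addr0.
Qed.

Lemma cscaleE (V : lmodType {poly K}) c (x : cspace V) :
  c *: x = (c%:P *: (x : V)) :> V.
Proof. by []. Qed.

Lemma cdel_linear (V : lmodType {poly K}) : linear (@cdel K V).
Proof.
move=> c x y; rewrite /cdel /del !cscaleE scalerDr !scalerA.
by congr (_ + _); rewrite mulrC.
Qed.

Lemma id_linear (U : lmodType K) : linear (@id U).
Proof. by []. Qed.

Definition bilinear_form (U W : lmodType {poly K}) (F : U -> W -> A) :=
  (forall (c : K) x x' y, F (c%:P *: x + x') y = c%:P%:P * F x y + F x' y) /\
  (forall (c : K) x y y', F x (c%:P *: y + y') = c%:P%:P * F x y + F x y').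

(** Scalars of K act on A through cspace, that is, as constant polynomials. *)
Definition clift (U W : lmodType {poly K}) (F : U -> W -> A) :
  ctensor U W -> cspace A := @tlift K (cspace U) (cspace W) (cspace A) F.

Section Clift.
Variables (U W : lmodType {poly K}) (F : U -> W -> A).
Hypothesis hF : bilinear_form F.

Lemma clift_linl b : linear (F^~ b : cspace U -> cspace A).
Proof.
have [hl _] := hF; move=> c x y; rewrite cscaleE; apply: etrans (hl _ _ _ _) _.
by rewrite cscaleE mul_polyC.
Qed.
Lemma clift_linr a : linear (F a : cspace W -> cspace A).
Proof.
have [_ hr] := hF; move=> c x y; rewrite cscaleE; apply: etrans (hr _ _ _ _) _.
by rewrite cscaleE mul_polyC.
Qed.

Lemma clift_tens a b : clift F (ctens a b) = F a b.
Proof.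
exact: (@tlift_tens K (cspace U) (cspace W) (cspace A) F clift_linl clift_linr).
Qed.

Lemma clift_linear : linear (clift F).
Proof.
exact: (@tlift_linear K (cspace U) (cspace W) (cspace A) F clift_linl
  clift_linr).
Qed.
End Clift.

End TensorExtra.

(** * Functionals on the triple tensor product *)

Section Triple.
Variables (K : fieldType) (L : lmodType {poly K}).
Local Notation A := {poly {poly K}}.
Local Notation L2 := (ctensor L L).
Local Notation L3 := (tensor L2 (cspace L)).

(** Pure tensors span. *)
Lemma tens3_ind (P : L3 -> Prop) :
    P 0 -> (forall x y, P x -> P y -> P (x + y)) ->
    (forall x y z, P (tens3 x y z)) -> forall t, P t.
Proof.
move=> P0 PD PT; apply: tensor_ind => // t z.
move: t; apply: (@tensor_ind K (cspace L) (cspace L) (fun t => P (tens t z))).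
- by rewrite (lin0 (@tens_linearl _ _ _ z)).
- by move=> x y Px Py; rewrite (linD (@tens_linearl _ _ _ z)); apply: PD.
- by move=> x y; apply: PT.
Qed.

Lemma del1_linear : linear (@del1 K L).
Proof.
apply: tmap_linear; last exact: id_linear.
by apply: tmap_linear; [exact: cdel_linear | exact: id_linear].
Qed.
Lemma del2_linear : linear (@del2 K L).
Proof.
apply: tmap_linear; last exact: id_linear.
by apply: tmap_linear; [exact: id_linear | exact: cdel_linear].
Qed.
Lemma del3_linear : linear (@del3 K L).
Proof. by apply: tmap_linear; [exact: id_linear | exact: cdel_linear]. Qed.

Lemma del1_tens3 (x y z : L) : del1 (tens3 x y z) = tens3 (del x) y z :> L3.
Proof.
have lin1 := tmap_linear (@cdel_linear K L) (@id_linear K (cspace L)).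
apply: etrans (tmap_tens lin1 (@id_linear K (cspace L)) (ctens x y) z) _.
apply: (congr1 (fun u => @tens K L2 (cspace L) u z)).
exact: (tmap_tens (@cdel_linear K L) (@id_linear K (cspace L))).
Qed.
Lemma del2_tens3 (x y z : L) : del2 (tens3 x y z) = tens3 x (del y) z :> L3.
Proof.
have lin2 := tmap_linear (@id_linear K (cspace L)) (@cdel_linear K L).
apply: etrans (tmap_tens lin2 (@id_linear K (cspace L)) (ctens x y) z) _.
apply: (congr1 (fun u => @tens K L2 (cspace L) u z)).
exact: (tmap_tens (@id_linear K (cspace L)) (@cdel_linear K L)).
Qed.
Lemma del3_tens3 (x y z : L) : del3 (tens3 x y z) = tens3 x y (del z) :> L3.
Proof. by rewrite /del3 /tens3 tmap_tens //; exact: cdel_linear. Qed.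

Lemma tens3_linear1 (c : K) (x x' y z : L) :
  tens3 (c%:P *: x + x') y z = c *: tens3 x y z + tens3 x' y z :> L3.
Proof. by rewrite /tens3 /ctens -tens_linearl -tens_linearl. Qed.
Lemma tens3_linear2 (c : K) (x y y' z : L) :
  tens3 x (c%:P *: y + y') z = c *: tens3 x y z + tens3 x y' z :> L3.
Proof. by rewrite /tens3 /ctens -tens_linearl -tens_linearr. Qed.
Lemma tens3_linear3 (c : K) (x y z z' : L) :
  tens3 x y (c%:P *: z + z') = c *: tens3 x y z + tens3 x y z' :> L3.
Proof. by rewrite /tens3 -tens_linearr. Qed.

Section Theta.
Variables (al be ga : L -> {poly K}) (D1 D2 D3 : A).
Hypotheses (hal : scalar al) (hbe : scalar be) (hga : scalar ga).

Let theta2 : L2 -> cspace A :=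
  clift (fun x y => peval D1 (al x) * peval D2 (be y)).

(** The functional al (x) be (x) ga, with del acting on the i-th factor as
    Di. *)
Definition theta : L3 -> cspace A :=
  @tlift K L2 (cspace L) (cspace A)
    (fun t z => (theta2 t : A) * peval D3 (ga z)).

Let theta2_bil : bilinear_form (fun x y => peval D1 (al x) * peval D2 (be y)).
Proof.
split=> [c x x' y|c x y y'].
  by rewrite hal pevalD pevalM pevalC; ring.
by rewrite hbe pevalD pevalM pevalC; ring.
Qed.

Let thetal z :
  linear (fun t : L2 => (theta2 t : A) * peval D3 (ga z) : cspace A).
Proof.
move=> c s t; rewrite [theta2 _](clift_linear theta2_bil) !cscaleE.
by rewrite mulrDl -scalerAl.
Qed.
Let thetar t :
  linear (fun z : cspace L => (theta2 t : A) * peval D3 (ga z) : cspace A).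
Proof.
move=> c x y; rewrite !cscaleE hga pevalD pevalM pevalC mulrDr; congr (_ + _).
by rewrite mulrCA mul_polyC.
Qed.

Lemma theta_linear : linear theta.
Proof. exact: (@tlift_linear K L2 (cspace L) (cspace A) _ thetal thetar). Qed.

Lemma theta_tens3 x y z :
  theta (tens3 x y z) = peval D1 (al x) * peval D2 (be y) * peval D3 (ga z).
Proof.
apply: etrans (@tlift_tens K L2 (cspace L) (cspace A) _ thetal thetar _ _) _.
by rewrite /theta2 (clift_tens theta2_bil).
Qed.

Lemma thetaD s t : theta (s + t) = theta s + theta t.
Proof. exact: (linD theta_linear). Qed.

Lemma theta_del1 t : theta (del1 t) = D1 * theta t.
Proof.
elim/tens3_ind: t => [|s t hs ht|x y z].
- by rewrite (lin0 del1_linear) (lin0 theta_linear) mulr0.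
- by rewrite (linD del1_linear) !thetaD hs ht mulrDr.
rewrite del1_tens3; apply: etrans (theta_tens3 _ _ _) _.
by rewrite theta_tens3 /del scalar_funZ // pevalM pevalX !mulrA.
Qed.
Lemma theta_del2 t : theta (del2 t) = D2 * theta t.
Proof.
elim/tens3_ind: t => [|s t hs ht|x y z].
- by rewrite (lin0 del2_linear) (lin0 theta_linear) mulr0.
- by rewrite (linD del2_linear) !thetaD hs ht mulrDr.
rewrite del2_tens3; apply: etrans (theta_tens3 _ _ _) _.
by rewrite theta_tens3 /del scalar_funZ // pevalM pevalX; ring.
Qed.
Lemma theta_del3 t : theta (del3 t) = D3 * theta t.
Proof.
elim/tens3_ind: t => [|s t hs ht|x y z].
- by rewrite (lin0 del3_linear) (lin0 theta_linear) mulr0.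
- by rewrite (linD del3_linear) !thetaD hs ht mulrDr.
rewrite del3_tens3; apply: etrans (theta_tens3 _ _ _) _.
by rewrite theta_tens3 /del scalar_funZ // pevalM pevalX; ring.
Qed.

(** The substitution of the derivation of a factor for lambda becomes the
    evaluation at the scalar M by which theta turns that derivation. *)
Lemma theta_vsubst (g : L -> L3) (d : L3 -> L3) (D M c : A)
    (de : L -> {poly K}) p :
    (forall t, theta (d t) = M * theta t) ->
    (forall x, theta (g x) = c * peval D (de x)) ->
  theta (vsubst g d p) = c * veval de D M p.
Proof.
move=> hd hg; rewrite /vsubst (lin_sum theta_linear) veval.unlock mulr_sumr.
apply: eq_bigr => n _; elim: n (p n) => [|n IHn] x; first by rewrite hg mul1r.
by rewrite iterS hd IHn exprS; ring.
Qed.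

Lemma theta_cybe_lhs (br : L -> L -> {vpoly L}) (s : seq (L * L)) :
  theta (cybe_lhs br s) = \sum_(p <- s) \sum_(q <- s)
    cybe_term (fun al D M x y => veval al D M (br x y)) al be ga D1 D2 D3 p q.
Proof.
rewrite (lin_sum theta_linear); apply: eq_bigr => p _.
rewrite (lin_sum theta_linear); apply: eq_bigr => q _.
rewrite /cybe_term; apply: etrans (linB theta_linear _ _) _.
apply: (congr2 (fun x y => x - y)).
  apply: etrans (linB theta_linear _ _) _.
  apply: (congr2 (fun x y => x - y)).
    apply: etrans (theta_vsubst (M := D2) (D := D1) (de := al)
      (c := peval D2 (be p.2) * peval D3 (ga q.2)) _ _ _) _;
      [exact: theta_del2 | | ring].
    by move=> x; apply: etrans (theta_tens3 _ _ _) _; ring.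
  apply: etrans (theta_vsubst (M := D3) (D := D2) (de := be)
    (c := peval D1 (al p.1) * peval D3 (ga q.2)) _ _ _) _;
    [exact: theta_del3 | | ring].
  by move=> x; apply: etrans (theta_tens3 _ _ _) _; ring.
apply: etrans (theta_vsubst (M := D2) (D := D3) (de := ga)
  (c := peval D1 (al p.1) * peval D2 (be q.1)) _ _ _) _;
  [exact: theta_del2 | | ring].
by move=> x; apply: etrans (theta_tens3 _ _ _) _; ring.
Qed.
End Theta.

Lemma linear_tens3_eq (W : lmodType K) (f g : L3 -> W) :
    linear f -> linear g ->
    (forall x y z, f (tens3 x y z) = g (tens3 x y z)) -> f =1 g.
Proof.
move=> hf hg fg; elim/tens3_ind => [|s t hs ht|//].
  by rewrite (lin0 hf) (lin0 hg).
by rewrite (linD hf) (linD hg) hs ht.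
Qed.

Lemma del12C (t : L3) : del1 (del2 t) = del2 (del1 t).
Proof.
move: t; apply: linear_tens3_eq => [||x y z].
- exact: (linear_comp del2_linear del1_linear).
- exact: (linear_comp del1_linear del2_linear).
apply: etrans (congr1 (@del1 K L) (del2_tens3 x y z)) _.
apply: etrans (del1_tens3 x (del y) z) (esym _).
apply: etrans (congr1 (@del2 K L) (del1_tens3 x y z)) _.
exact: (del2_tens3 (del x) y z).
Qed.

Lemma del13C (t : L3) : del1 (del3 t) = del3 (del1 t).
Proof.
move: t; apply: linear_tens3_eq => [||x y z].
- exact: (linear_comp del3_linear del1_linear).
- exact: (linear_comp del1_linear del3_linear).
apply: etrans (congr1 (@del1 K L) (del3_tens3 x y z)) _.
apply: etrans (del1_tens3 x y (del z)) (esym _).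
apply: etrans (congr1 (@del3 K L) (del1_tens3 x y z)) _.
exact: (del3_tens3 (del x) y z).
Qed.

Lemma del23C (t : L3) : del2 (del3 t) = del3 (del2 t).
Proof.
move: t; apply: linear_tens3_eq => [||x y z].
- exact: (linear_comp del3_linear del2_linear).
- exact: (linear_comp del2_linear del3_linear).
apply: etrans (congr1 (@del2 K L) (del3_tens3 x y z)) _.
apply: etrans (del2_tens3 x y (del z)) (esym _).
apply: etrans (congr1 (@del3 K L) (del2_tens3 x y z)) _.
exact: (del3_tens3 x (del y) z).
Qed.

End Triple.

(** * Vanishing modulo the total derivation *)

(** In the application W is L (x) L (x) L, tau builds pure tensors, d1, d2, d3
    are the derivations of the three factors, b and bs are dual bases, and
    th p is [theta] for the triple p of elements of bs. *)
Section Criterion.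
Variables (K : fieldType) (L : lmodType {poly K}) (W : lmodType K).
Local Notation A := {poly {poly K}}.
Variables (tau : L -> L -> L -> W) (d1 d2 d3 : W -> W).
Hypotheses (d1_lin : linear d1) (d2_lin : linear d2) (d3_lin : linear d3).
Hypothesis d12C : forall t, d1 (d2 t) = d2 (d1 t).
Hypothesis d13C : forall t, d1 (d3 t) = d3 (d1 t).
Hypothesis d23C : forall t, d2 (d3 t) = d3 (d2 t).
Hypothesis tau1 : forall (c : K) x x' y z,
  tau (c%:P *: x + x') y z = c *: tau x y z + tau x' y z.
Hypothesis tau2 : forall (c : K) x y y' z,
  tau x (c%:P *: y + y') z = c *: tau x y z + tau x y' z.
Hypothesis tau3 : forall (c : K) x y z z',
  tau x y (c%:P *: z + z') = c *: tau x y z + tau x y z'.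
Hypothesis d1_tau : forall x y z, d1 (tau x y z) = tau (del x) y z.
Hypothesis d2_tau : forall x y z, d2 (tau x y z) = tau x (del y) z.
Hypothesis d3_tau : forall x y z, d3 (tau x y z) = tau x y (del z).
Hypothesis tau_ind : forall P : W -> Prop,
    P 0 -> (forall x y, P x -> P y -> P (x + y)) ->
    (forall x y z, P (tau x y z)) -> forall t, P t.
Variables (I : finType) (b : I -> L) (bs : I -> L -> {poly K}).
Hypothesis bdecomp : forall x, x = \sum_i bs i x *: b i.
Implicit Type p : (I * I * I)%type.

Variable th : I * I * I -> W -> cspace A.
Hypothesis th_lin : forall p, linear (th p).
Hypothesis th_d1 : forall p t, th p (d1 t) = 'X%:P * (th p t : A).
Hypothesis th_d2 : forall p t, th p (d2 t) = 'X * (th p t : A).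
Hypothesis th_d3 : forall p t, th p (d3 t) = (- 'X%:P - 'X) * (th p t : A).
Hypothesis th_b : forall p q,
  th p (tau (b q.1.1) (b q.1.2) (b q.2)) = ((p == q)%:R : A).

Let tot (t : W) : W := d1 t + d2 t + d3 t.

Let tot_lin : linear tot.
Proof. by apply: linear_add => //; apply: linear_add. Qed.

Let gterm p (l : nat) (c : {poly K}) : W :=
  tau (c *: b p.1.1) ('X^l *: b p.1.2) (b p.2).

(* The polynomial P(d1, d2) applied to the basis tensor of index p; as d1 and d2
   come from the action of del on the first two factors, no polynomial in
   operators is needed. *)
Let Psi p (P : A) : W := \sum_(l < size P) gterm p l P`_l.

Let gtermD p l c d : gterm p l (c + d) = gterm p l c + gterm p l d.
Proof.
have := tau1 1 (c *: b p.1.1) (d *: b p.1.1) ('X^l *: b p.1.2) (b p.2).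
by rewrite !scale1r -scalerDl.
Qed.

Let gterm0 p l : gterm p l 0 = 0.
Proof. by apply: (addrI (gterm p l 0)); rewrite -gtermD !addr0. Qed.

Let Psi_wide p (P : A) N : (size P <= N)%N ->
  Psi p P = \sum_(l < N) gterm p l P`_l.
Proof.
move=> hN; rewrite /Psi (big_ord_widen _ (fun l => gterm p l P`_l) hN).
rewrite big_mkcond /=; apply: eq_bigr => l _; case: ltnP => // hl.
by rewrite nth_default // gterm0.
Qed.

Let PsiD p P Q : Psi p (P + Q) = Psi p P + Psi p Q.
Proof.
have hN := size_polyD P Q; rewrite (Psi_wide p hN).
rewrite (Psi_wide p (leq_maxl (size P) (size Q))).
rewrite (Psi_wide p (leq_maxr (size P) (size Q))) -big_split /=.
by apply: eq_bigr => l _; rewrite coefD gtermD.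
Qed.

Let Psi_1 p (P : A) : Psi p ('X%:P * P) = d1 (Psi p P).
Proof.
have hs : (size ('X%:P * P)%R <= size P)%N by rewrite mul_polyC size_scale_leq.
rewrite (Psi_wide p hs) (lin_sum d1_lin); apply: eq_bigr => l _.
by rewrite coefCM d1_tau /gterm -scalerA.
Qed.

Let Psi_2 p (P : A) : Psi p ('X * P) = d2 (Psi p P).
Proof.
have hs : (size ('X * P)%R <= (size P).+1)%N.
  have [->|P0] := eqVneq P 0; first by rewrite mulr0 size_poly0.
  by rewrite mulrC size_mulX.
rewrite (Psi_wide p hs) big_ord_recl coefXM gterm0 add0r (lin_sum d2_lin).
apply: eq_bigr => l _; rewrite coefXM /= d2_tau /gterm.
by rewrite /bump /= add1n /del scalerA exprS.
Qed.

Let PsiC p (c : K) (P : A) : Psi p (c%:P%:P * P) = c *: Psi p P.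
Proof.
have hs : (size (c%:P%:P * P)%R <= size P)%N.
  by rewrite mul_polyC size_scale_leq.
rewrite (Psi_wide p hs) scaler_sumr; apply: eq_bigr => l _.
rewrite coefCM /gterm -scalerA.
have := tau1 c (P`_l *: b p.1.1) 0 ('X^l *: b p.1.2) (b p.2).
rewrite !addr0 => ->; have := gterm0 p l; rewrite /gterm scale0r => ->.
by rewrite addr0.
Qed.

Let N (t : W) : W := \sum_p Psi p (th p t).

Let thD p s t : th p (s + t) = th p s + th p t.
Proof. exact: (linD (th_lin p)). Qed.
Let thZ p c t : th p (c *: t) = c%:P%:P * th p t.
Proof.
by rewrite (linZ (th_lin p)) cscaleE mul_polyC.
Qed.

Let ND s t : N (s + t) = N s + N t.
Proof. by rewrite -big_split; apply: eq_bigr => p _; rewrite thD PsiD. Qed.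
Let NZ c t : N (c *: t) = c *: N t.
Proof. by rewrite scaler_sumr; apply: eq_bigr => p _; rewrite thZ PsiC. Qed.
Let NN t : N (- t) = - N t.
Proof. by rewrite -scaleN1r NZ scaleN1r. Qed.
Let N1 t : N (d1 t) = d1 (N t).
Proof.
rewrite (lin_sum d1_lin); apply: eq_bigr => p _; rewrite -Psi_1.
by congr (Psi p _); exact: th_d1.
Qed.
Let N2 t : N (d2 t) = d2 (N t).
Proof.
rewrite (lin_sum d2_lin); apply: eq_bigr => p _; rewrite -Psi_2.
by congr (Psi p _); exact: th_d2.
Qed.
(* The normal form lets d3 act as - d1 - d2. *)
Let N3 t : N (d3 t) = - d1 (N t) - d2 (N t).
Proof.
rewrite -N1 -N2 -!NN -ND; apply: eq_bigr => p _; congr (Psi p _).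
rewrite thD -scaleN1r thZ -[- d2 t]scaleN1r thZ !polyCN !polyC1.
rewrite th_d3 th_d1 th_d2.
by rewrite mulrBl mulNr !mulN1r.
Qed.

Let Cong (t : W) := exists w, t - N t = tot w.

Let Cong0 : Cong 0.
Proof.
have N0 : N 0 = 0 by have := NZ 0 0; rewrite !scale0r.
by exists 0; rewrite (lin0 tot_lin) N0 subrr.
Qed.
Let CongD s t : Cong s -> Cong t -> Cong (s + t).
Proof.
move=> [w hw] [w' hw']; exists (w + w').
by rewrite (linD tot_lin) ND opprD addrACA hw hw'.
Qed.
Let CongZ c t : Cong t -> Cong (c *: t).
Proof.
by move=> [w hw]; exists (c *: w); rewrite (linZ tot_lin) NZ -scalerBr hw.
Qed.
Let Cong1 t : Cong t -> Cong (d1 t).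
Proof.
move=> [w hw]; exists (d1 w); rewrite N1 -(linB d1_lin) hw /tot.
by rewrite !(linD d1_lin) d12C d13C.
Qed.
Let Cong2 t : Cong t -> Cong (d2 t).
Proof.
move=> [w hw]; exists (d2 w); rewrite N2 -(linB d2_lin) hw /tot.
by rewrite !(linD d2_lin) -d12C d23C.
Qed.
Let Cong3 t : Cong t -> Cong (d3 t).
Proof.
(* Replacing d3 by - d1 - d2 on N t costs the total derivative of N t. *)
move=> [w hw]; exists (d3 w + N t).
have -> : tot (d3 w + N t) = d3 (tot w) + tot (N t).
  rewrite (linD tot_lin); congr (_ + _).
  by rewrite /tot !(linD d3_lin) d13C d23C.
rewrite -hw (linB d3_lin) N3 /tot opprD !opprK.
by rewrite [RHS]addrACA addNr addr0.
Qed.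

Let Cong_b p : Cong (tau (b p.1.1) (b p.1.2) (b p.2)).
Proof.
exists 0; rewrite (lin0 tot_lin); apply/eqP; rewrite subr_eq0; apply/eqP.
rewrite /N (bigD1 p) //= big1 ?addr0 => [|q qp]; last first.
  by rewrite th_b (negPf qp) /Psi size_poly0 big_ord0.
by rewrite th_b eqxx /Psi size_poly1 big_ord1 coef1 /gterm /= !scale1r.
Qed.

(* Used with g = tau in one of its arguments and d the derivation of the
   corresponding factor. *)
Let Cong_slot (g : L -> W) (d : W -> W) :
    (forall (c : K) x y, g (c%:P *: x + y) = c *: g x + g y) ->
    (forall x, g (del x) = d (g x)) ->
    (forall t, Cong t -> Cong (d t)) ->
    (forall i, Cong (g (b i))) ->
  forall x, Cong (g x).
Proof.
move=> gl gd dC gb x.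
have g0 : g 0 = 0.
  by have := gl (-1) 0 0; rewrite scaler0 addr0 scaleN1r addNr.
have gD u w : g (u + w) = g u + g w.
  by have := gl 1 u w; rewrite !scale1r.
rewrite [x]bdecomp; elim/big_rec: _ => [|i y _ gy]; first by rewrite g0.
rewrite gD; apply: CongD => //.
elim/poly_ind: (bs i x) => [|q c IHq]; first by rewrite scale0r g0.
rewrite mulrC scalerDl -scalerA gD gd; apply: CongD; first exact: dC.
by have := gl c (b i) 0; rewrite g0 !addr0 => ->; apply: CongZ.
Qed.

(** The element t is congruent to its normal form N t, which depends only on
    the polynomials th p t: the congruence is true for tensors of basis
    elements and is inherited under d1, d2 and d3. *)
Lemma mod_total_criterion (t : W) :
  (forall p, th p t = 0) -> exists w, t = d1 w + d2 w + d3 w.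
Proof.
move=> t0; suff [w hw] : Cong t.
  exists w; apply: etrans hw; rewrite /N big1 ?subr0 // => p _.
  by rewrite t0 /Psi size_poly0 big_ord0.
elim/tau_ind: t {t0} => [|s t|x y z]; [exact: Cong0 | exact: CongD |].
apply: (Cong_slot (g := fun x => tau x y z) (d := d1)) => [c u w|u||i].
- exact: tau1.
- by rewrite d1_tau.
- exact: Cong1.
apply: (Cong_slot (g := fun y => tau (b i) y z) (d := d2)) => [c u w|u||j].
- exact: tau2.
- by rewrite d2_tau.
- exact: Cong2.
apply: (Cong_slot (g := fun z => tau (b i) (b j) z) (d := d3)) => [c u w|u||k].
- exact: tau3.
- by rewrite d3_tau.
- exact: Cong3.
exact: (Cong_b (i, j, k)).
Qed.
End Criterion.

(** * Reduction of r_T modulo the total derivation *)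

Section OpEval.
Variable K : fieldType.

(** A linear map that kills the image of P sees only the part of a of degree 0
    in its first variable.  It is used for P = lambda, to compute T_0, and for
    P = - 1 (x) del - del (x) 1, to reduce r_T. *)
Lemma opeval_quotient (W U : lmodType K) (G : W -> U) (P Q : W -> W)
    (a : {poly {poly K}}) w :
    linear G -> (forall u, G (P u) = 0) ->
  G (opeval a P Q w) = \sum_(l < size a`_0) a`_0`_l *: G (iter l Q w).
Proof.
move=> G_lin GP; rewrite /opeval (lin_sum G_lin).
case: (size a) (@nth_default _ 0 a 0%N) => [|s] a0.
  by rewrite big_ord0 a0 // size_poly0 big_ord0.
rewrite big_ord_recl [X in _ + X]big1 ?addr0 => [|k _].
  by rewrite (lin_sum G_lin); apply: eq_bigr => l _; rewrite (linZ G_lin).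
rewrite (lin_sum G_lin) big1 // => l _.
by rewrite (linZ G_lin) iterS GP scaler0.
Qed.

Lemma poly_scale_sum (U : lmodType {poly K}) (p : {poly K}) (x : U) :
  p *: x = \sum_(l < size p) (p`_l)%:P *: iter l (@del K U) x.
Proof.
have iterE l : iter l (@del K U) x = 'X^l *: x.
  by elim: l => [|l IHl]; rewrite ?scale1r // iterS IHl /del scalerA exprS.
rewrite -{1}[p]coefK poly_def scaler_suml; apply: eq_bigr => l _.
by rewrite iterE scalerA mul_polyC.
Qed.
End OpEval.

Section ReducedTensor.
Variables (K : fieldType) (R V : lmodType {poly K}).
Local Notation A := {poly {poly K}}.
Local Notation L := (R * cdual V)%type.
Variables (m n : nat) (e : 'I_n -> R) (vs : 'I_m -> cdual V).
Variable a : 'I_m -> 'I_n -> A.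

Lemma inl_lin : linear ((fun x : R => (x, 0)) : cspace R -> cspace L).
Proof. by move=> c x y; rewrite !cscaleE inl_linear. Qed.
Lemma inr_lin :
  linear ((fun f : cdual V => (0, f)) : cspace (cdual V) -> cspace L).
Proof. by move=> c x y; rewrite !cscaleE inr_linear. Qed.

Lemma tensor_inj_linear : linear (@tensor_inj K R V).
Proof. exact: (tmap_linear inl_lin inr_lin). Qed.

Lemma tensor_inj_tens (x : R) (f : cdual V) :
  tensor_inj (ctens x f) = ctens ((x, 0) : L) ((0, f) : L).
Proof. exact: (tmap_tens inl_lin inr_lin). Qed.

Variable F : L -> L -> A.
Hypothesis hF : balanced F.

Let bilF : bilinear_form F.
Proof. by case: hF. Qed.

Let G (t : ctensor R (cdual V)) : cspace A :=
  clift F (tensor_inj t - tflip (tensor_inj t)).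

Let G_lin : linear G.
Proof.
move=> c s t; rewrite /G tensor_inj_linear tflip_linear opprD addrACA -scalerBr.
exact: (clift_linear bilF).
Qed.

Let G_tens x f : G (ctens x f) = F (x, 0) (0, f) - F (0, f) (x, 0).
Proof.
rewrite /G tensor_inj_tens tflip_tens (linB (clift_linear bilF)).
by apply: (congr2 (fun x y => x - y)); exact: (clift_tens bilF).
Qed.

Let dl : ctensor R (cdual V) -> ctensor R (cdual V) := tmap (@cdel K R) id.
Let dr : ctensor R (cdual V) -> ctensor R (cdual V) :=
  tmap id (@cdel K (cdual V)).

Let dl_lin : linear dl.
Proof. by apply: tmap_linear; [exact: cdel_linear | exact: id_linear]. Qed.
Let dr_lin : linear dr.
Proof. by apply: tmap_linear; [exact: id_linear | exact: cdel_linear]. Qed.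
Let dl_tens x f : dl (ctens x f) = ctens (del x) f.
Proof. by apply: tmap_tens; [exact: cdel_linear | exact: id_linear]. Qed.
Let dr_tens x f : dr (ctens x f) = ctens x (del f).
Proof. by apply: tmap_tens; [exact: id_linear | exact: cdel_linear]. Qed.

Let G_total t : G (- dr t - dl t) = 0.
Proof.
have [_ _ Fd] := hF.
rewrite (linB G_lin) (linN G_lin).
suff : G (dl t) + G (dr t) = 0 by move=> h; rewrite -opprD addrC h oppr0.
have sum_lin :=
  linear_add (linear_comp dl_lin G_lin) (linear_comp dr_lin G_lin).
apply: (linear_tens_eq0 sum_lin) => x f.
apply: etrans (congr2 +%R (etrans (congr1 G (dl_tens x f)) (G_tens _ _))
                          (etrans (congr1 G (dr_tens x f)) (G_tens _ _))) _.
have -> : (del x, 0 : cdual V) = del ((x, 0) : L).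
  by rewrite /del; congr (_, _); rewrite /= scaler0.
have -> : (0 : R, del f) = del ((0, f) : L).
  by rewrite /del; congr (_, _); rewrite /= scaler0.
by rewrite addrACA -opprD Fd add0r addrC Fd oppr0.
Qed.

(** A balanced form kills the image of del (x) 1 + 1 (x) del, so only the values
    at lambda = 0 of the a_ij survive.  The list s is arbitrary: a balanced
    form depends only on the tensor that s represents. *)
Lemma balanced_r_T (s : seq (L * L)) :
    tensor_inj (r_T e vs a) - tflip (tensor_inj (r_T e vs a)) =
      \sum_(p <- s) ctens p.1 p.2 ->
  let t i := \sum_j (a i j)`_0 *: e j in
  \sum_(p <- s) F p.1 p.2 =
  \sum_i (F (t i, 0) (0, vs i) - F (0, vs i) (t i, 0)).
Proof.
move=> hs t; transitivity (G (r_T e vs a)).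
  rewrite /G hs (lin_sum (clift_linear bilF)); apply: eq_bigr => p _.
  by rewrite (clift_tens bilF).
rewrite (lin_sum G_lin); apply: eq_bigr => i _; rewrite -G_tens (lin_sum G_lin).
have ctl f :
    linear ((fun x : R => ctens x f) : cspace R -> ctensor R (cdual V)).
  exact: tens_linearl.
rewrite [ctens (t i) _](lin_sum (ctl (vs i))) (lin_sum G_lin).
apply: eq_bigr => j _.
have tE : ctens ((a i j)`_0 *: e j) (vs i) =
    \sum_(l < size (a i j)`_0) (a i j)`_0`_l *: iter l dl (ctens (e j) (vs i)).
  rewrite poly_scale_sum; apply: etrans (lin_sum (ctl (vs i)) _ _ _) _.
  apply: eq_bigr => l _; apply: etrans (linZ (ctl (vs i)) _ _) _.
  apply: (congr1 (fun u => _ *: u)).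
  by elim: (l : nat) => [|k IHk] //; rewrite !iterS -IHk; apply/esym/dl_tens.
apply: etrans (opeval_quotient _ _ _ G_lin G_total) _.
rewrite tE; apply: etrans _ (esym (lin_sum G_lin _ _ _)).
by apply: eq_bigr => l _; apply/esym/(linZ G_lin).
Qed.
End ReducedTensor.

(** * O-operators and the Yang-Baxter equation *)

Lemma eq_cybe_term (K : fieldType) (L : lmodType {poly K})
    (B B' : (L -> {poly K}) -> {poly {poly K}} -> {poly {poly K}} -> L -> L ->
      {poly {poly K}}) al be ga D1 D2 D3 p q :
    (forall al D M x y, scalar al -> B al D M x y = B' al D M x y) ->
    scalar al -> scalar be -> scalar ga ->
  cybe_term B al be ga D1 D2 D3 p q = cybe_term B' al be ga D1 D2 D3 p q.
Proof. by move=> eB ha hb hg; rewrite /cybe_term !eB. Qed.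

Section Main.
Variables (K : fieldType) (R V : lmodType {poly K}).
Local Notation A := {poly {poly K}}.
Local Notation L := (R * cdual V)%type.
Local Notation L3 := (tensor (ctensor L L) (cspace L)).
Variables (br : R -> R -> {vpoly R}) (rho : R -> V -> {vpoly V}).
Hypothesis sb : conformal_sesquilinear br.
Hypothesis sr : conformal_sesquilinear rho.
Hypothesis skew : forall a b, br a b = - vflip (br b a).
Variables (n m : nat) (e : 'I_n -> R) (he : is_basis e).
Variables (v : 'I_m -> V) (hv : is_basis v).
Variables (vs : 'I_m -> cdual V) (hvs : forall i k, vs i (v k) = (i == k)%:R).
Variable a : 'I_m -> 'I_n -> A.
Local Notation B := (bracket_eval v vs rho br).
Local Notation r_a :=
  (tensor_inj (r_T e vs a) - tflip (tensor_inj (r_T e vs a))).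

Local Notation t_a := (fun i => \sum_j (a i j)`_0 *: e j).

(** The summand is balanced in each of the two pairs separately, so both
    occurrences of r can be replaced by the reduced one. *)
Lemma theta_cybe_r_T (al be ga : L -> {poly K}) D1 D2 D3 (s : seq (L * L)) :
    scalar al -> scalar be -> scalar ga -> D1 + D2 + D3 = 0 ->
    r_a = \sum_(p <- s) ctens p.1 p.2 ->
  theta al be ga D1 D2 D3 (cybe_lhs (semidirect_bracket rho br) s) =
  cybe_RVV v vs br rho t_a (restr_l al) (restr_r be) (restr_r ga) D1 D2 D3
  - cybe_RVV v vs br rho t_a (restr_l be) (restr_r al) (restr_r ga) D2 D1 D3
  + cybe_RVV v vs br rho t_a (restr_l ga) (restr_r al) (restr_r be) D3 D1 D2.
Proof.
move=> ha hb hg D123 hs; pose t := t_a.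
pose f := cybe_term B al be ga D1 D2 D3.
have hB : semilinear_bracket B.
  move=> x D M hx; split=> *; first exact: bracket_eval_linl.
  exact: bracket_eval_linr.
have fl q : \sum_(p <- s) f p q =
    \sum_i (f ((t i, 0), (0, vs i)) q - f ((0, vs i), (t i, 0)) q).
  have <- := balanced_r_T (cybe_term_balanced_l hB ha hb hg D123 q) hs.
  by apply: eq_bigr => -[].
have fr p : \sum_(q <- s) f p q =
    \sum_i (f p ((t i, 0), (0, vs i)) - f p ((0, vs i), (t i, 0))).
  have <- := balanced_r_T (cybe_term_balanced_r hB ha hb hg D123 p) hs.
  by apply: eq_bigr => -[].
rewrite theta_cybe_lhs // -(cybe_term_split v vs sb sr skew t ha hb hg D123).
transitivity (\sum_(p <- s) \sum_(q <- s) f p q).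
  apply: eq_bigr => p _; apply: eq_bigr => q _.
  apply: eq_cybe_term => // x D M y z hx; exact: (veval_semidirect hv hvs sr).
under eq_bigr do rewrite fr.
rewrite exchange_big [RHS]exchange_big; apply: eq_bigr => j _ /=.
rewrite sumrB !fl -sumrB; apply: eq_bigr => i _; rewrite -/f.
by rewrite !opprB addrACA [RHS]addrACA; congr (_ + _); exact: addrC.
Qed.

Variables (T : V -> {vpoly R}) (hT : Chom T).
Hypothesis ha : forall i, (T (v i) : cspace {vpoly R}) =
  \sum_j opeval (a i j) (@vX _ R : cspace {vpoly R} -> cspace {vpoly R})
    (@cdel _ {vpoly R}) (vconst (e j)).
Let T0 u := T u 0%N.

(** At lambda = 0 the twisted rule for T(del v) becomes K[del]-linearity. *)
Lemma Chom0_linear : linear T0.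
Proof.
have T0l (c : K) u w : T0 (c%:P *: u + w) = c%:P *: T0 u + T0 w.
  by rewrite /T0 (Chom_linear hT).
have T0d u : T0 ('X *: u) = 'X *: T0 u.
  by rewrite /T0 [T _](Chom_del hT) fsfunDE vXE addr0.
have T00 : T0 0 = 0.
  by have := T0l (-1) 0 0; rewrite scaler0 addr0 polyCN scaleN1r addNr.
have T0D u w : T0 (u + w) = T0 u + T0 w.
  by have := T0l 1 u w; rewrite polyC1 !scale1r.
move=> p u w; rewrite T0D; congr (_ + _).
elim/poly_ind: p => [|p c IHp]; first by rewrite !scale0r.
rewrite mulrC !scalerDl -!scalerA T0D T0d IHp; congr (_ + _).
by have := T0l c u 0; rewrite T00 !addr0.
Qed.

Lemma Chom0_basis i : T0 (v i) = \sum_j (a i j)`_0 *: e j.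
Proof.
have G_lin : linear ((fun p => p 0%N) : cspace {vpoly R} -> cspace R) by [].
rewrite /T0 ha; apply: etrans (lin_sum G_lin _ _ _) _; apply: eq_bigr => j _.
apply: etrans (opeval_quotient _ _ _ G_lin _) _ => [p|].
  exact: (@vXE _ R p 0%N).
rewrite poly_scale_sum; apply: eq_bigr => l _.
apply: (congr1 (fun x => _ *: x)).
elim: (l : nat) => [|k IHk]; first by rewrite /= fssingleE.
by rewrite !iterS -IHk.
Qed.

Lemma cybe_RVV_eq0 (al : R -> {poly K}) (be ga : cdual V -> {poly K}) D1 D2 D3 :
    scalar al -> D1 + D2 + D3 = 0 ->
    (forall i j, O_defect br rho T0 (v i) (v j) = 0) ->
  cybe_RVV v vs br rho (T0 \o v) al be ga D1 D2 D3 = 0.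
Proof.
move=> hal D123 d0.
rewrite (cybe_RVV_defect hv hvs _ _ Chom0_linear hal _ _ D123).
by rewrite big1 // => i _; rewrite big1 // => j _; rewrite d0 veval0 // mulr0.
Qed.

Let T0vE : t_a = T0 \o v.
Proof. by apply/funext => i; rewrite /= Chom0_basis. Qed.

Let D0 : 'X%:P + 'X + (- 'X%:P - 'X) = 0 :> A.
Proof. by rewrite addrACA !addrN addr0. Qed.

Lemma cybe_of_O_operator :
  O_operator br rho T0 -> cybe_solution (semidirect_bracket rho br) r_a.
Proof.
move=> [_ hO] s hs; have [es hes] := dual_basis_exists he.
have d0 i j : O_defect br rho T0 (v i) (v j) = 0.
  by apply/eqP; rewrite subr_eq0 -hO.
pose b (i : 'I_n + 'I_m) : L :=
  match i with inl j => (e j, 0) | inr k => (0, vs k) end.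
pose bs (i : 'I_n + 'I_m) (x : L) : {poly K} :=
  match i with inl j => es j x.1 | inr k => dcoord v k x.2 end.
have hbs i : scalar (bs i).
  case: i => i p x y; [exact: cdual_scalar | exact: dcoord_scalar].
have bsb i j : bs i (b j) = (i == j)%:R.
  case: i j => i [] j /=; rewrite ?hes //.
  - exact/scalar_fun0/cdual_scalar.
  - exact/scalar_fun0/dcoord_scalar.
  by rewrite (dcoord_vs hvs) eq_sym.
have bdecomp x : x = \sum_i bs i x *: b i.
  have inlS (F : 'I_n -> R) : (\sum_j F j, 0) = \sum_j (F j, 0) :> L.
    by elim/big_rec2: _ => // i y z _ <-; congr (_, _); rewrite /= addr0.
  have inrS (F : 'I_m -> cdual V) : (0, \sum_k F k) = \sum_k (0, F k) :> L.
    by elim/big_rec2: _ => // i y z _ <-; congr (_, _); rewrite /= addr0.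
  transitivity ((x.1, 0) + (0, x.2) : L).
    by case: x => y f; congr (_, _); rewrite /= ?addr0 ?add0r.
  rewrite big_sumType /= {1}[x.1](vs_decomp he hes).
  rewrite {1}[x.2](cdual_decomp hv hvs).
  rewrite inlS inrS; congr (_ + _); apply: eq_bigr => i _.
    by congr (_, _); rewrite /= scaler0.
  by congr (_, _); rewrite /= scaler0.
clearbody b bs.
have crit := @mod_total_criterion K L L3 (@tens3 K L) (@del1 K L) (@del2 K L)
  (@del3 K L) (@del1_linear K L) (@del2_linear K L) (@del3_linear K L)
  (@del12C K L) (@del13C K L) (@del23C K L) (@tens3_linear1 K L)
  (@tens3_linear2 K L) (@tens3_linear3 K L) (@del1_tens3 K L)
  (@del2_tens3 K L) (@del3_tens3 K L) (@tens3_ind K L) _ b bs bdecomp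
  (fun p => theta (bs p.1.1) (bs p.1.2) (bs p.2) 'X%:P 'X (- 'X%:P - 'X)).
apply: crit => [p|p t|p t|p t|p q|p].
- exact: (theta_linear _ _ _ (hbs _) (hbs _) (hbs _)).
- exact: (theta_del1 _ _ _ (hbs _) (hbs _) (hbs _)).
- exact: (theta_del2 _ _ _ (hbs _) (hbs _) (hbs _)).
- exact: (theta_del3 _ _ _ (hbs _) (hbs _) (hbs _)).
- apply: etrans (theta_tens3 _ _ _ (hbs _) (hbs _) (hbs _) _ _ _) _.
  case: p q => [[p1 p2] p3] [[q1 q2] q3] /=; rewrite !bsb !xpair_eqE.
  by rewrite !(rmorph_nat (peval _)) -!natrM !mulnb.
have hs' := theta_cybe_r_T (hbs p.1.1) (hbs p.1.2) (hbs p.2) D0 hs.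
apply: etrans hs' _; rewrite T0vE !cybe_RVV_eq0 ?subr0 ?addr0 //.
- exact: restr_l_scalar.
- by ring.
- exact: restr_l_scalar.
- by ring.
exact: restr_l_scalar.
Qed.

(** Test the equation against the coordinates of e_l, v_i^* and v_j^* in the
    three factors.  Each of them vanishes on R or on V^*c, so only the
    component in R (x) V^*c (x) V^*c is seen; what is left of it is the
    coordinate along e_l of the defect at (v_i, v_j). *)
Lemma O_operator_of_cybe :
  cybe_solution (semidirect_bracket rho br) r_a -> O_operator br rho T0.
Proof.
move=> sol; have [es hes] := dual_basis_exists he.
split; first exact: Chom0_linear.
suff d0 i j : O_defect br rho T0 (v i) (v j) = 0.
  move=> u w; apply/eqP; rewrite -subr_eq0; apply/eqP.
  exact: (O_defect_eq0 hv hvs sb sr Chom0_linear he hes d0).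
apply: (@veval_inj _ _ _ (fun l => es l : R -> {poly K})) => [l|x y exy|l].
- exact/scalar_fun0/cdual_scalar.
- rewrite [x](vs_decomp he hes) [y](vs_decomp he hes).
  by apply: eq_bigr => l _; rewrite exy.
rewrite (veval0 (es l)).
pose al (x : L) : {poly K} := es l x.1.
pose be (x : L) : {poly K} := dcoord v i x.2.
pose ga (x : L) : {poly K} := dcoord v j x.2.
have hal : scalar al by move=> p x y; exact: cdual_scalar.
have hbe : scalar be by move=> p x y; exact: dcoord_scalar.
have hga : scalar ga by move=> p x y; exact: dcoord_scalar.
have [s hs] := tensor_span r_a; have [w hw] := sol s hs.
have := theta_cybe_r_T hal hbe hga D0 hs; rewrite T0vE hw.
have -> : theta al be ga 'X%:P 'X (- 'X%:P - 'X) (del1 w + del2 w + del3 w) = 0.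
  have th_lin := theta_linear 'X%:P 'X (- 'X%:P - 'X) hal hbe hga.
  have th1 := theta_del1 'X%:P 'X (- 'X%:P - 'X) hal hbe hga w.
  have th2 := theta_del2 'X%:P 'X (- 'X%:P - 'X) hal hbe hga w.
  have th3 := theta_del3 'X%:P 'X (- 'X%:P - 'X) hal hbe hga w.
  apply: etrans (linD th_lin _ _) _; apply: etrans (congr2 +%R _ th3) _.
    exact: etrans (linD th_lin _ _) (congr2 +%R th1 th2).
  by rewrite -!mulrDl D0 mul0r.
have dz k : dcoord v k 0 = 0 by exact/scalar_fun0/dcoord_scalar.
have D1 : 'X + 'X%:P + (- 'X%:P - 'X) = 0 :> A by ring.
have D2 : - 'X%:P - 'X + 'X%:P + 'X = 0 :> A by ring.
have RVV0 g be' ga' E1 E2 E3 : scalar g -> (forall x, g x = 0) ->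
    E1 + E2 + E3 = 0 -> cybe_RVV v vs br rho (T0 \o v) g be' ga' E1 E2 E3 = 0.
  move=> hg g0 E0.
  rewrite (cybe_RVV_defect hv hvs br rho Chom0_linear hg _ _ E0).
  rewrite big1 // => k _; rewrite big1 // => k' _.
  by rewrite veval.unlock big1 ?mulr0 // => r _; rewrite g0 rmorph0 mulr0.
rewrite (RVV0 _ _ _ _ _ _ (restr_l_scalar hbe) _ D1) => [|x]; last exact: dz.
rewrite (RVV0 _ _ _ _ _ _ (restr_l_scalar hga) _ D2) => [|x]; last exact: dz.
have hal_l := restr_l_scalar hal.
rewrite (cybe_RVV_defect hv hvs br rho Chom0_linear hal_l _ _ D0).
rewrite subr0 addr0 => /esym; apply: etrans; apply/esym.
rewrite (bigD1 i) //= [X in _ + X]big1 ?addr0 => [|k ki]; last first.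
  rewrite big1 // => k' _; rewrite /restr_r /be /= (dcoord_vs hvs) (negPf ki).
  by rewrite rmorph0 !mul0r.
rewrite (bigD1 j) //= [X in _ + X]big1 ?addr0 => [|k kj]; last first.
  rewrite /restr_r /ga /= (dcoord_vs hvs) (negPf kj).
  by rewrite rmorph0 mulr0 mul0r.
by rewrite /restr_r /be /ga /= !(dcoord_vs hvs) !eqxx !rmorph1 !mul1r.
Qed.
End Main.

Theorem theorem3p7 (rT : realType)
  (R V : lmodType {poly rT[i]})
  (br : R -> R -> {vpoly R}) (hbr : lie_conformal br)
  (rho : R -> V -> {vpoly V}) (hrho : conformal_rep br rho)
  (n m : nat) (e : 'I_n -> R) (he : is_basis e)
  (v : 'I_m -> V) (hv : is_basis v)
  (vs : 'I_m -> cdual V) (hvs : forall i k, vs i (v k) = (i == k)%:R)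
  (T : V -> {vpoly R}) (hT : Chom T)
  (a : 'I_m -> 'I_n -> {poly {poly rT[i]}})
  (ha : forall i, (T (v i) : cspace {vpoly R}) =
    \sum_j opeval (a i j) (@vX _ R : cspace {vpoly R} -> cspace {vpoly R})
      (@cdel _ {vpoly R}) (vconst (e j))) :
  cybe_solution (semidirect_bracket rho br)
    (tensor_inj (r_T e vs a) - tflip (tensor_inj (r_T e vs a)))
  <-> O_operator br rho (fun u => T u 0%N).
Proof.
have [sb skew _] := hbr; have [sr _] := hrho.
split; first exact: (O_operator_of_cybe sb sr skew he hv hvs hT ha).
exact: (cybe_of_O_operator sb sr skew he hv hvs hT ha).
Qed.
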